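(* Let $\Omega\subset\mathbb{R}^N$ be a bounded open connected set and $\Theta$ a proper elliptic map on $\Omega$ such that for every open $X\subset\subset\Omega$ the following holds: for all sufficiently large $R>0$ and all $\eta>0$ there exists $\delta=\delta(R,\eta,X)>0$ such that for all $x,y\in X$ with $|x-y|<\delta$, $$\big(\Theta(x)\cap([-R,R]\times\mathcal{S}(N))\big)+(0,\eta I)\subset\Theta(y).$$ If $u\in\mathrm{USC}(\overline\Omega)$ is $\Theta$-subharmonic in $\Omega$, $v\in\mathrm{LSC}(\overline\Omega)$ is $\Theta$-superharmonic in $\Omega$, and $u\le v$ on $\partial\Omega$, then $u\le v$ in $\Omega$.
   Context: $\mathcal{S}(N)$: real symmetric $N\times N$ matrices with the usual partial order; $I$ identity. $\mathcal{Q}:=\{(s,P): s\le0,\ P\ge0\}$. A proper elliptic map $\Theta$ on $\Omega$ assigns to each $x$ a closed, nonempty set $\Theta(x)\subsetneq\mathbb{R}\times\mathcal{S}(N)$ with $\Theta(x)+\mathcal{Q}\subset\Theta(x)$. $J^+_{x_0}u:=\{(\varphi(x_0),D^2\varphi(x_0)):\varphi$ is $C^2$ near $x_0$, $u\le\varphi$ near $x_0$, $u(x_0)=\varphi(x_0)\}$, $J^-_{x_0}u$ likewise with $u\ge\varphi$. $u\in\mathrm{USC}(\Omega)$ is $\Theta$-subharmonic in $\Omega$ if $J^+_{x_0}u\subset\Theta(x_0)$ for all $x_0\in\Omega$; $v\in\mathrm{LSC}(\Omega)$ is $\Theta$-superharmonic in $\Omega$ if $J^-_{x_0}v\subset(\mathbb{R}\times\mathcal{S}(N))\setminus(\Theta(x_0))^\circ$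 for all $x_0\in\Omega$. *)

(* Defs.v *)
From HB Require Import structures.
From mathcomp Require Import all_boot all_order all_algebra.
From mathcomp Require Import all_classical all_reals all_analysis.
Set Implicit Arguments. Unset Strict Implicit. Unset Printing Implicit Defensive.
Import Order.TTheory GRing.Theory Num.Theory.
Import numFieldNormedType.Exports.
Local Open Scope classical_set_scope.
Local Open Scope ring_scope.

Section Defs.
Variables (R : realType) (N : nat).

Definition symmx (A : 'M[R]_N) : Prop := A^T = A.

Definition psdmx (P : 'M[R]_N) : Prop :=
  symmx P /\ forall v : 'rV[R]_N, 0 <= (v *m P *m v^T) 0 0.

Definition evec (i : 'I_N) : 'rV[R]_N := delta_mx 0 i.

Definition pderiv (i : 'I_N) (f : 'rV[R]_N -> R) : 'rV[R]_N -> R :=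
  fun x => 'D_(evec i) f x.

Definition C2_on (U : set 'rV[R]_N) (f : 'rV[R]_N -> R) : Prop :=
  forall x, U x ->
    [/\ {for x, continuous f},
        forall j, derivable f x (evec j) /\ {for x, continuous (pderiv j f)}
      & forall i j, derivable (pderiv j f) x (evec i) /\
                    {for x, continuous (pderiv i (pderiv j f))}].

Definition hessian (f : 'rV[R]_N -> R) (x : 'rV[R]_N) : 'M[R]_N :=
  \matrix_(i, j) pderiv i (pderiv j f) x.

Definition superjet (u : 'rV[R]_N -> R) (x0 : 'rV[R]_N) : set (R * 'M[R]_N) :=
  [set p | exists (phi : 'rV[R]_N -> R) (rho : R), 0 < rho /\
     C2_on (ball x0 rho) phi /\
     (forall x, ball x0 rho x -> u x <= phi x) /\ u x0 = phi x0 /\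
     p = (phi x0, hessian phi x0)].

Definition subjet (v : 'rV[R]_N -> R) (x0 : 'rV[R]_N) : set (R * 'M[R]_N) :=
  [set p | exists (phi : 'rV[R]_N -> R) (rho : R), 0 < rho /\
     C2_on (ball x0 rho) phi /\
     (forall x, ball x0 rho x -> v x >= phi x) /\ v x0 = phi x0 /\
     p = (phi x0, hessian phi x0)].

(* interior of a subset of R x S(N), relative to the space R x S(N) *)
Definition sym_interior (A : set (R * 'M[R]_N)) : set (R * 'M[R]_N) :=
  [set p | symmx p.2 /\ exists e : R, 0 < e /\
     forall s (Y : 'M[R]_N), symmx Y -> `|s - p.1| < e -> `|Y - p.2| < e ->
       A (s, Y)].

Definition proper_elliptic (Omega : set 'rV[R]_N)
    (Theta : 'rV[R]_N -> set (R * 'M[R]_N)) : Prop :=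
  forall x, Omega x ->
    [/\ (forall p, Theta x p -> symmx p.2),
        closed (Theta x),
        Theta x !=set0,
        (exists p : R * 'M[R]_N, symmx p.2 /\ ~ Theta x p)
      & forall r A s P, Theta x (r, A) -> s <= 0 -> psdmx P ->
          Theta x (r + s, A + P)].

Definition usc_on (K : set 'rV[R]_N) (u : 'rV[R]_N -> R) : Prop :=
  forall x, K x -> forall e : R, 0 < e -> exists d : R, 0 < d /\
    forall y, K y -> `|y - x| < d -> u y < u x + e.

Definition lsc_on (K : set 'rV[R]_N) (v : 'rV[R]_N -> R) : Prop :=
  forall x, K x -> forall e : R, 0 < e -> exists d : R, 0 < d /\
    forall y, K y -> `|y - x| < d -> v x - e < v y.

Definition subharmonic (Omega : set 'rV[R]_N)
    (Theta : 'rV[R]_N -> set (R * 'M[R]_N)) (u : 'rV[R]_N -> R) : Prop :=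
  forall x0, Omega x0 -> superjet u x0 `<=` Theta x0.

Definition superharmonic (Omega : set 'rV[R]_N)
    (Theta : 'rV[R]_N -> set (R * 'M[R]_N)) (v : 'rV[R]_N -> R) : Prop :=
  forall x0, Omega x0 -> subjet v x0 `<=` ~` sym_interior (Theta x0).

Definition compactly_in (X Omega : set 'rV[R]_N) : Prop :=
  compact (closure X) /\ closure X `<=` Omega.

Definition theta_unif_cont (Omega : set 'rV[R]_N)
    (Theta : 'rV[R]_N -> set (R * 'M[R]_N)) : Prop :=
  forall X : set 'rV[R]_N, open X -> compactly_in X Omega ->
    exists R0 : R, forall Rr : R, R0 <= Rr -> 0 < Rr ->
      forall eta : R, 0 < eta -> exists delta : R, 0 < delta /\
        forall x y, X x -> X y -> `|x - y| < delta ->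
          forall r A, Theta x (r, A) -> `|r| <= Rr ->
            Theta y (r, A + eta%:M).

End Defs.

(* Main.v *)
Require Import Defs.
From HB Require Import structures.
From mathcomp Require Import all_boot all_order all_algebra.
From mathcomp Require Import all_classical all_reals all_analysis.
From mathcomp Require Import ring lra zify.
Import Order.TTheory GRing.Theory Num.Theory.
Import numFieldNormedType.Exports.
Local Open Scope classical_set_scope.
Local Open Scope ring_scope.

(** Suppose [u > v] somewhere and make [u] strict by adding a small multiple
    of [|x|^2 - C].  Quadratic sup- and inf-convolutions of [u] and [v] leave a
    function [phi] of class C^{1,1} (a Lasry-Lions regularization) which
    separates them: for each small slope [p] the maximum of the doubled
    functional is attained at a contact point [y_p] where [phi] touches both,
    the upper one up to an affine function, and [|p - p'| <= 4 |y_p - y_p'|],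
    so that the contact points have positive density at every scale.

    Instead of Alexandrov's and Jensen's theorems, a quantitative
    differentiation argument on lattices is used.  The mixed second difference
    quotients of [phi] at scale [2h] are averages of those at scale [h]; their
    l^2 energies are thus monotone and bounded, so at some scale the third
    differences are small at most lattice points, in particular near a contact
    point.  There [phi] is within [eta rho^2] of a quadratic polynomial on a
    ball of radius [rho].  Sliding this polynomial, corrected by
    [+- 4 eta |y - y_p|^2], gives test functions touching [u] from above at
    [z1] and [v] from below at [z2], with [z1] close to [z2], [u z1 > v z2] and
    Hessians differing by [O(eta)], which contradicts the continuity of
    [Theta]. *)

(** * Euclidean norm *)

Section EuclideanNorm.
Set Implicit Arguments. Unset Strict Implicit.
Variables (R : realType) (N : nat).
Implicit Types (x y z : 'rV[R]_N) (a b t : R).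

(** The norm [|x|] on row vectors is the sup norm, so the Euclidean structure needed by the
    quadratic penalties is set up separately; passing between the two costs a factor [N]. *)
Definition dot x y : R := \sum_i x 0 i * y 0 i.

Definition normsq x : R := dot x x.

Lemma dotC x y : dot x y = dot y x.
Proof. by apply: eq_bigr => i _; rewrite mulrC. Qed.

Lemma dotDl x y z : dot (x + y) z = dot x z + dot y z.
Proof. by rewrite -big_split; apply: eq_bigr => i _; rewrite mxE mulrDl. Qed.

Lemma dotNl x y : dot (- x) y = - dot x y.
Proof. by rewrite -sumrN; apply: eq_bigr => i _; rewrite mxE mulNr. Qed.

Lemma dotZl a x y : dot (a *: x) y = a * dot x y.
Proof. by rewrite mulr_sumr; apply: eq_bigr => i _; rewrite mxE mulrA. Qed.

Lemma dotDr x y z : dot z (x + y) = dot z x + dot z y.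
Proof. by rewrite ![dot z _]dotC dotDl. Qed.

Lemma dotNr x y : dot y (- x) = - dot y x.
Proof. by rewrite ![dot y _]dotC dotNl. Qed.

Lemma dotZr a x y : dot y (a *: x) = a * dot y x.
Proof. by rewrite ![dot y _]dotC dotZl. Qed.

Definition dotE := (dotDl, dotDr, dotNl, dotNr, dotZl, dotZr).

Lemma normsq_ge0 x : 0 <= normsq x.
Proof. by apply: sumr_ge0 => i _; rewrite -expr2 sqr_ge0. Qed.

Lemma normsqN x : normsq (- x) = normsq x.
Proof. by rewrite /normsq !dotE opprK. Qed.

Lemma normsqB x y : normsq (x - y) = normsq (y - x).
Proof. by rewrite -normsqN opprB. Qed.

Lemma norm_rV_le x t : 0 <= t -> (forall i, `|x 0 i| <= t) -> `|x| <= t.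
Proof.
move=> t0 xt; rewrite /Num.Def.normr /= mx_normrE.
by apply/bigmax_leP; split=> // -[i j] _ /=; rewrite (ord1 i).
Qed.

Lemma coord_le_norm m n (A : 'M[R]_(m, n)) i j : `|A i j| <= `|A|.
Proof.
rewrite [leRHS]/Num.Def.normr /= mx_normrE.
by apply: (@le_bigmax _ _ _ 0 (fun ij => `|A ij.1 ij.2|) (i, j)).
Qed.

Lemma norm_sqr_le_normsq x : `|x| ^+ 2 <= normsq x.
Proof.
rewrite -[leRHS]sqr_sqrtr ?normsq_ge0 // ler_pXn2r ?nnegrE ?sqrtr_ge0 //.
apply: norm_rV_le => [|i]; first exact: sqrtr_ge0.
rewrite -sqrtr_sqr ler_sqrt ?normsq_ge0 // /normsq /dot (bigD1 i) //= -expr2.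
by rewrite lerDl; apply: sumr_ge0 => j _; rewrite -expr2 sqr_ge0.
Qed.

Lemma dot_le_norm x y : `|dot x y| <= N%:R * (`|x| * `|y|).
Proof.
apply: le_trans (ler_norm_sum _ _ _) _.
rewrite mulr_natl -[X in _ *+ X](card_ord N) -sumr_const; apply: ler_sum => i _.
by rewrite normrM ler_pM ?normr_ge0 ?coord_le_norm.
Qed.

Lemma normsq_le_norm x : normsq x <= N%:R * `|x| ^+ 2.
Proof. by rewrite expr2; apply: le_trans (ler_norm _) (dot_le_norm _ _). Qed.

Lemma norm_le_of_normsq x t : 0 <= t -> normsq x <= t ^+ 2 -> `|x| <= t.
Proof.
move=> t0 xt; rewrite -(@ler_pXn2r _ 2) ?nnegrE //.
exact: le_trans (norm_sqr_le_normsq x) xt.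
Qed.

Lemma normsqD_le x y : normsq (x + y) <= 2 * normsq x + 2 * normsq y.
Proof.
have := normsq_ge0 (x - y); rewrite /normsq !dotE (dotC y x); lra.
Qed.

(** Exact convexity defect of the squared norm, the source of the factor [t * (1 - t)] in [C11]. *)
Lemma normsq_convex t x y :
  normsq ((1 - t) *: x + t *: y) =
  (1 - t) * normsq x + t * normsq y - t * (1 - t) * normsq (x - y).
Proof. rewrite /normsq !dotE (dotC y x); ring. Qed.

Lemma normsq_sub_convex t z x y :
  normsq (z - ((1 - t) *: x + t *: y)) =
  (1 - t) * normsq (z - x) + t * normsq (z - y) - t * (1 - t) * normsq (x - y).
Proof.
rewrite -[normsq (x - y)]normsqB (_ : y - x =
  (z - x) - (z - y)) -?normsq_convex.
  by congr normsq; apply/rowP => i; rewrite !mxE; ring.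
by apply/rowP => i; rewrite !mxE; ring.
Qed.

End EuclideanNorm.

(** * Finite differences and lattice energies *)

Section FiniteDifferences.
Set Implicit Arguments. Unset Strict Implicit.
Variables (R : realType) (N : nat).
Implicit Types (f : 'rV[R]_N -> R) (x y a b c : 'rV[R]_N).

Definition diff2 f a b y : R := f (y + a + b) - f (y + a) - f (y + b) + f y.

Definition diff3 f a b c y : R := diff2 f a b (y + c) - diff2 f a b y.

(** Equivalently, [f + K normsq] is convex and [f - K normsq] is concave: a C^{1,1} bound stated
    without derivatives. *)
Definition C11 (K : R) f := forall x y t, 0 <= t <= 1 ->
  `|f ((1 - t) *: x + t *: y) - ((1 - t) * f x + t * f y)|
     <= K * (t * (1 - t)) * normsq (x - y).

(** The diagonals of the parallelogram share their midpoint, so the values there cancel when [C11]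
    is applied to both with [t = 1/2]; the squared diagonals add up to
    [2 * (normsq a + normsq b)]. *)
Lemma diff2_le K f a b y : C11 K f ->
  `|diff2 f a b y| <= K * (normsq a + normsq b).
Proof.
move=> fK; have h01 : 0 <= (2^-1 : R) <= 1 by lra.
have := fK (y + a + b) y _ h01; have := fK (y + a) (y + b) _ h01.
have -> : (1 - 2^-1) *: (y + a) + 2^-1 *: (y + b) =
          (1 - 2^-1) *: (y + a + b) + 2^-1 *: y.
  by apply/rowP => i; rewrite !mxE; field.
have -> : normsq (y + a - (y + b)) = normsq a + normsq b - 2 * dot a b.
  rewrite /normsq !dotE [dot a y]dotC [dot b y]dotC [dot b a]dotC; ring.
have -> : normsq (y + a + b - y) = normsq a + normsq b + 2 * dot a b.
  rewrite /normsq !dotE [dot a y]dotC [dot b y]dotC [dot b a]dotC; ring.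
rewrite /diff2 !ler_norml => /andP[h1 h2] /andP[h3 h4].
by apply/andP; split; lra.
Qed.

Lemma diff2C f a b y : diff2 f a b y = diff2 f b a y.
Proof. by rewrite /diff2 (addrAC y a b); ring. Qed.

(** A difference with doubled step is the sum of a difference and its translate; this is used in
    both directions. *)
Lemma diff2_double f a b y : diff2 f (a + a) (b + b) y =
  diff2 f a b y + diff2 f a b (y + a) + diff2 f a b (y + b)
  + diff2 f a b (y + a + b).
Proof.
by rewrite /diff2 !addrA !(addrAC _ b a); ring.
Qed.

(* [2 T_a D_a D_c D_b = D_{a+c}^2 D_b - D_a^2 D_b - T_a^2 D_c^2 D_b], with
   [T_a] the translation by [a] and [D_a = T_a - 1]. *)
Lemma diff3_polarization f a b c y :
  2 * diff3 f a c b (y + a) =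
  diff3 f (a + c) b (a + c) y - diff3 f a b a y - diff3 f c b c (y + a + a).
Proof.
by rewrite /diff3 /diff2 !addrA !(addrAC _ c a, addrAC _ b a, addrAC _ b c);
  ring.
Qed.

End FiniteDifferences.

(** * Sums over cubes of lattice points *)

Section LatticeSums.
Set Implicit Arguments. Unset Strict Implicit.
Variables (R : realType) (N : nat).
Implicit Types (G : 'rV[R]_N -> R) (y o : 'rV[R]_N) (s : R).

Lemma ler_sum_inj (I J : finType) (h : I -> J) (F : J -> R) :
  injective h -> (forall j, 0 <= F j) -> \sum_i F (h i) <= \sum_j F j.
Proof.
move=> hi F0.
have -> : \sum_i F (h i) = \sum_(j in h @: @predT I) F j.
  by rewrite big_imset //=; move=> x y _ _; exact: hi.
rewrite [leRHS](bigID (mem (h @: @predT I))) /= lerDl.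
by apply: sumr_ge0.
Qed.

Definition natrv (k : 'I_N -> nat) : 'rV[R]_N := \row_i (k i)%:R.

Definition boxsum o s n G : R := \sum_(k : {ffun 'I_N -> 'I_n})
  G (o + s *: natrv (fun i => k i)).

Lemma natrvD k l : natrv (fun i => k i + l i)%N = natrv k + natrv l.
Proof. by apply/rowP => i; rewrite !mxE natrD. Qed.

Lemma natrvM m k : natrv (fun i => m * k i)%N = m%:R *: natrv k.
Proof. by apply/rowP => i; rewrite !mxE natrM. Qed.

(** The shifted cube embeds injectively into the wider one and all terms are nonnegative. Cubes are
    not translation invariant, so every shift is paid for in width. *)
Lemma le_boxsum_shift o s n n' c G : (forall y, 0 <= G y) ->
  (forall i, c i + n <= n')%N ->
  boxsum o s n (fun y => G (y + s *: natrv c)) <= boxsum o s n' G.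
Proof.
move=> G0 cn.
have lt (k : {ffun 'I_N -> 'I_n}) i : (k i + c i < n')%N.
  by apply: leq_trans (cn i); rewrite addnC ltn_add2l.
pose h (k : {ffun 'I_N -> 'I_n}) := [ffun i => Ordinal (lt k i)].
have hi : injective h.
  move=> k k' /ffunP hk; apply/ffunP => i.
  have /(congr1 val) /= := hk i; rewrite !ffunE /= => /addIn e.
  exact/val_inj.
apply: le_trans (ler_sum_inj hi _) => //=.
rewrite /boxsum; apply: ler_sum => k _; rewrite le_eqVlt; apply/orP; left.
apply/eqP; congr G; rewrite -addrA -scalerDr -natrvD; congr (_ + _ *: _).
by apply/rowP => i; rewrite !mxE ffunE.
Qed.

Lemma le_boxsum_width o s n n' G : (forall y, 0 <= G y) -> (n <= n')%N ->
  boxsum o s n G <= boxsum o s n' G.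
Proof.
move=> G0 nn'; have := @le_boxsum_shift o s n n' (fun=> 0%N) G G0 (fun=> nn').
apply: le_trans; rewrite /boxsum; apply: ler_sum => k _.
have -> : natrv (fun=> 0%N) = 0 by apply/rowP => i; rewrite !mxE.
by rewrite scaler0 addr0.
Qed.

Lemma le_boxsum o s n G G' : (forall y, G y <= G' y) ->
  boxsum o s n G <= boxsum o s n G'.
Proof. by move=> GG'; apply: ler_sum => k _. Qed.

Lemma boxsumD o s n G G' :
  boxsum o s n (fun y => G y + G' y) = boxsum o s n G + boxsum o s n G'.
Proof. by rewrite /boxsum big_split. Qed.

Lemma boxsumZ o s n (x : R) G :
  boxsum o s n (fun y => x * G y) = x * boxsum o s n G.
Proof. by rewrite /boxsum mulr_sumr. Qed.

Lemma boxsum_le_const o s n G (B : R) : (forall y, G y <= B) ->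
  boxsum o s n G <= n%:R ^+ N * B.
Proof.
move=> GB; apply: le_trans (le_boxsum _ _ _ GB) _.
by rewrite /boxsum sumr_const card_ffun !card_ord -natrX mulr_natl.
Qed.

Lemma boxsum_ge0 o s n G : (forall y, 0 <= G y) -> 0 <= boxsum o s n G.
Proof. by move=> G0; apply: sumr_ge0. Qed.

End LatticeSums.

(** * Monotonicity of the energy of second differences under doubling of the scale *)

Section EnergyDecay.
Set Implicit Arguments. Unset Strict Implicit.
Variables (R : realType) (N : nat) (f : 'rV[R]_N -> R) (o : 'rV[R]_N) (s : R).
Variables ca cb : 'I_N -> nat.
Hypothesis cab : forall i, (ca i + cb i <= 4)%N.

Local Notation a := (s *: natrv R ca).
Local Notation b := (s *: natrv R cb).

(** Dividing by [4 ^+ j] makes the value on quadratic polynomials independent of the scale [j]. *)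
Definition quot2 j y : R :=
  diff2 f ((2 ^ j)%:R *: a) ((2 ^ j)%:R *: b) y / 4 ^+ j.

Lemma quot2S j y : quot2 j.+1 y = (quot2 j y
  + quot2 j (y + (2 ^ j)%:R *: a) + quot2 j (y + (2 ^ j)%:R *: b)
  + quot2 j (y + (2 ^ j)%:R *: a + (2 ^ j)%:R *: b)) / 4.
Proof.
rewrite /quot2 expnS mulnC muln2 -addnn natrD !scalerDl diff2_double exprS.
have : (4 ^+ j : R) != 0 by rewrite expf_neq0.
by move=> ?; field.
Qed.

(** Variance argument: [quot2 j.+1] is the mean of four values of [quot2 j], so passing to squares
    loses energy, and the loss controls a third difference. Since [ca i + cb i <= 4], the four
    translates fit into a cube wider by [4 * 2 ^ j]. *)
Lemma boxsum_quot2S j n :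
  boxsum o s n (fun y => quot2 j.+1 y ^+ 2)
  + 16^-1 * boxsum o s n
      (fun y => (quot2 j (y + (2 ^ j)%:R *: a) - quot2 j y) ^+ 2)
  <= boxsum o s (n + 2 ^ (j + 2)) (fun y => quot2 j y ^+ 2).
Proof.
pose Q := fun y => quot2 j y ^+ 2.
have Q0 y : 0 <= Q y by rewrite sqr_ge0.
have bnd (x1 x2 : nat) : (x1 <= 1)%N -> (x2 <= 1)%N ->
    boxsum o s n (fun y =>
      Q (y + (s *: natrv R (fun i => 2 ^ j * (x1 * ca i + x2 * cb i))%N)))
    <= boxsum o s (n + 2 ^ (j + 2)) Q.
  move=> h1 h2; apply: le_boxsum_shift => // i.
  rewrite addnC leq_add2l expnD leq_pmul2l ?expn_gt0 //.
  by apply: leq_trans (cab i); apply: leq_add; rewrite -[leqRHS]mul1n leq_mul.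
have e x1 x2 y : y + s *: natrv R (fun i => 2 ^ j * (x1 * ca i + x2 * cb i))%N =
   y + x1%:R *: ((2 ^ j)%:R *: a) + x2%:R *: ((2 ^ j)%:R *: b).
  rewrite natrvM natrvD !natrvM -addrA !scalerDr !scalerA.
  by congr (_ + (_ *: _ + _ *: _)); ring.
have := bnd 0%N 0%N isT isT; have := bnd 0%N 1%N isT isT.
have := bnd 1%N 0%N isT isT; have := bnd 1%N 1%N isT isT.
set S11 := boxsum _ _ _ _; set S := boxsum o s (n + _) _ => h11.
set S10 := boxsum _ _ _ _ => h10; set S01 := boxsum _ _ _ _ => h01.
set S00 := boxsum _ _ _ _ => h00.
have : S00 + S10 + S01 + S11 <= 4 * S by lra.
suff : boxsum o s n (fun y => quot2 j.+1 y ^+ 2)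
  + 16^-1 * boxsum o s n
      (fun y => (quot2 j (y + (2 ^ j)%:R *: a) - quot2 j y) ^+ 2)
  <= 4^-1 * (S00 + S10 + S01 + S11) by move=> H1 H2; apply: le_trans H1 _; lra.
rewrite /S00 /S10 /S01 /S11 -boxsumZ -!boxsumD -boxsumZ; apply: le_boxsum => y.
rewrite !e !scale0r !scale1r !addr0 quot2S /Q.
move: (quot2 _ _) (quot2 _ _) (quot2 _ _) (quot2 _ _) => w x z t.
rewrite -subr_ge0.
set lhs := (X in 0 <= X).
(* The mean of four squares exceeds the square of the mean by a sixteenth of the six squared
   pairwise differences. One of the six is the third difference kept on the left; these are the
   other five. *)
have -> : lhs = 16^-1 * ((x - w) ^+ 2 + (z - w) ^+ 2 + (t - w) ^+ 2
   + (x - z) ^+ 2 + (x - t) ^+ 2).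
  by rewrite /lhs; field.
by rewrite mulr_ge0 ?invr_ge0 // !addr_ge0 ?sqr_ge0.
Qed.

(** The energies telescope over the scales, and the successive widenings form a geometric series
    bounded by [2 ^ (J + 2)]. *)
Lemma sum_boxsum_quot2 J n :
  boxsum o s n (fun y => quot2 J y ^+ 2)
  + 16^-1 * \sum_(j < J) boxsum o s n
      (fun y => (quot2 j (y + (2 ^ j)%:R *: a) - quot2 j y) ^+ 2)
  <= boxsum o s (n + 2 ^ (J + 2)) (fun y => quot2 0 y ^+ 2).
Proof.
elim: J n => [|J IH] n.
  rewrite big_ord0 mulr0 addr0; apply: le_boxsum_width => [y|].
    exact: sqr_ge0.
  exact: leq_addr.
rewrite big_ord_recr /=.
have h1 := boxsum_quot2S J n.
have h2 := IH (n + 2 ^ (J + 2))%N.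
rewrite addSn expnS mul2n -addnn addnA.
apply: le_trans h2.
set S := \sum_(j < J) boxsum o s n _;
  set S' := \sum_(j < J) boxsum o s (n + _) _.
have SS' : S <= S'.
  apply: ler_sum => j _; apply: le_boxsum_width => [y|]; first exact: sqr_ge0.
  exact: leq_addr.
by lra.
Qed.

(** The number [J] of scales enters the bound only through the width of the cube. With the width
    under control, the third differences are therefore small on average over the scales. *)
Lemma sum_boxsum_diff3 (B : R) J n : (forall y, `|diff2 f a b y| <= B) ->
  \sum_(j < J) boxsum o s n (fun y =>
     (diff3 f ((2 ^ j)%:R *: a) ((2 ^ j)%:R *: b) ((2 ^ j)%:R *: a) y
       / 4 ^+ j) ^+ 2)
  <= 16 * (B ^+ 2 * (n + 2 ^ (J + 2))%:R ^+ N).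
Proof.
move=> fB; have := sum_boxsum_quot2 J n.
have h0 : 0 <= boxsum o s n (fun y => quot2 J y ^+ 2).
  by apply: boxsum_ge0 => y; exact: sqr_ge0.
have h1 : boxsum o s (n + 2 ^ (J + 2)) (fun y => quot2 0 y ^+ 2) <=
    (n + 2 ^ (J + 2))%:R ^+ N * B ^+ 2.
  apply: boxsum_le_const => y; rewrite /quot2 expr0 divr1 expn0 !scale1r.
  rewrite -real_normK ?num_real // ler_pXn2r ?nnegrE ?normr_ge0 //.
  exact: le_trans (normr_ge0 _) (fB y).
set S := \sum_(j < J) _ => hS; set S' := (X in X <= _).
have -> : S' = S.
  apply: eq_bigr => j _; apply: eq_bigr => k _.
  by rewrite /diff3 /quot2 mulrBl.
by rewrite (mulrC (B ^+ 2)); lra.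
Qed.

End EnergyDecay.

(** * Quadratic approximation of C11 functions *)

Section QuadraticFit.
Set Implicit Arguments. Unset Strict Implicit.
Variables (R : realType) (N : nat).
Implicit Types (f : 'rV[R]_N -> R) (x y z g : 'rV[R]_N) (S : 'M[R]_N).
Implicit Types (i k l : 'I_N).

Definition quad (c : R) g S x : R := c + dot g x + 2^-1 * dot (x *m S) x.

Lemma dot0r x : dot x 0 = 0.
Proof. by rewrite -(scale0r 0) dotZr mul0r. Qed.

Lemma dot_sym S x y : symmx S -> dot (x *m S) y = dot (y *m S) x.
Proof.
have e (u v : 'rV[R]_N) : dot u v = (u *m v^T) 0 0.
  by rewrite mxE; apply: eq_bigr => i _; rewrite mxE.
move=> Ss; rewrite !e -mulmxA -[in LHS]Ss -trmx_mul.
by rewrite -e dotC e.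
Qed.

Lemma diff2_quad c g S z x a b : symmx S ->
  diff2 (fun x => quad c g S (x - z)) a b x = dot (a *m S) b.
Proof.
move=> Ss; rewrite /diff2 /quad.
have -> : x + a + b - z =
    (x - z) + a + b by rewrite -!addrA (addrC (- z)) !addrA.
have -> : x + a - z = (x - z) + a by rewrite addrAC.
have -> : x + b - z = (x - z) + b by rewrite addrAC.
move: (x - z) => w; rewrite !mulmxDl !dotE.
by rewrite (dot_sym w b Ss) (dot_sym w a Ss) (dot_sym b a Ss); field.
Qed.

Lemma natrvS p (i : 'I_N) : 
  natrv R (fun m => p m + (m == i))%N = natrv R p + evec R i.
Proof. by rewrite natrvD; congr (_ + _); apply/rowP=> m; rewrite !mxE. Qed.

Lemma dot_evecr x i : dot x (evec R i) = x 0 i.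
Proof.
rewrite /dot (bigD1 i) //= big1 ?addr0 => [|j /negPf ji].
  by rewrite [X in _ * X]mxE !eqxx mulr1.
by rewrite [X in _ * X]mxE ji andbF mulr0.
Qed.

Lemma normsq_evec (i : 'I_N) : normsq (evec R i : 'rV_N) = 1.
Proof. by rewrite /normsq dot_evecr mxE !eqxx. Qed.

Lemma normsqZ (a : R) x : normsq (a *: x) = a ^+ 2 * normsq x.
Proof. by rewrite /normsq !dotE mulrA expr2. Qed.

Lemma dot_evec S i k (a b : R) :
  dot ((a *: evec R i) *m S) (b *: evec R k) = a * b * S i k.
Proof.
by rewrite -scalemxAl !dotE mulrA dot_evecr -rowE mxE.
Qed.

Lemma quad_evec c g S z y i (a : R) : symmx S ->
  quad c g S (y + a *: evec R i - z) = quad c g S (y - z)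
    + a * (g 0 i + ((y - z) *m S) 0 i) + a ^+ 2 * (2^-1 * S i i).
Proof.
move=> Ss; rewrite /quad (addrAC y _ (- z)); move: (y - z) => w.
rewrite mulmxDl !(dotDl, dotDr) dot_evec (dot_sym (a *: evec R i) w Ss) !dotZr.
by rewrite !dot_evecr; field.
Qed.

(** Discrete mean value inequality: a monotone lattice path from [0] to [p] has at most [N * M]
    steps. The induction is on the length of the path. *)
Lemma lattice_walk (F : 'rV[R]_N -> R) z (h : R) M (B : R) : 0 <= B ->
    F z = 0 ->
  (forall p i, (forall m, p m <= M)%N ->
    `|F (z + h *: natrv R p + h *: evec R i) - F (z + h *: natrv R p)| <= B) ->
  forall p, (forall m, p m <= M)%N ->
    `|F (z + h *: natrv R p)| <= (N * M)%:R * B.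
Proof.
move=> B0 Fz FB p pM.
suff : `|F (z + h *: natrv R p)| <= (\sum_m p m)%:R * B.
  move/le_trans; apply; apply: ler_wpM2r => //; rewrite ler_nat.
  rewrite -[X in (X * _)%N](card_ord N) -sum_nat_const; exact: leq_sum.
move: {2}(\sum_m p m)%N (erefl (\sum_m p m)%N) => n.
elim: n p pM => [|n IH] p pM e.
  have p0 m : p m = 0%N by move: e; rewrite (bigD1 m) //=; lia.
  have -> : natrv R p = 0 by apply/rowP=> m; rewrite !mxE p0.
  by rewrite scaler0 addr0 Fz normr0 e mul0r.
have [i pi] : exists i, (0 < p i)%N.
  apply: contrapT => /forallNP H; move: e; rewrite big1 // => i _.
  by have := H i; case: (p i).
pose p' m := (p m - (m == i))%N.
have pp' m : p m = (p' m + (m == i))%N.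
  by rewrite /p' subnK //; case: eqP => // ->.
have p'M m : (p' m <= M)%N by apply: leq_trans (pM m); rewrite /p' leq_subr.
have e' : (\sum_m p' m)%N = n.
  have : (\sum_m p m = \sum_m p' m + 1)%N.
    rewrite (eq_bigr _ (fun m _ => pp' m)) big_split /=; congr addn.
    by rewrite (bigD1 i) //= eqxx big1 // => j /negPf ->.
  by rewrite e addn1 => -[].
have -> : natrv R p = natrv R p' + evec R i.
  by rewrite -natrvS; congr natrv; apply/funext => m; exact: pp'.
have h2 := IH _ p'M e'; have h1 := FB _ i p'M; rewrite e' in h2.
rewrite e -natr1 scalerDr addrA mulrDl mul1r.
rewrite -[X in `|X|](subrK (F (z + h *: natrv R p'))).
by apply: le_trans (ler_normD _ _) _; lra.
Qed.

(** Passage from lattice points to the whole cube, one coordinate at a time: [k] counts the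
    coordinates already freed, and freeing one costs the interpolation error [d]. *)
Lemma lattice_fill (r : 'rV[R]_N -> R) z (h : R) M (d B : R) : 0 < h ->
  (forall x i t, 0 <= t <= 1 ->
    `|r (x + (t * h) *: evec R i) - ((1 - t) * r x + t * r (x + h *: evec R i))|
       <= d) ->
  (forall p, (forall m, p m <= M)%N -> `|r (z + h *: natrv R p)| <= B) ->
  forall y, (forall i, z 0 i <= y 0 i < z 0 i + h * M%:R) ->
  `|r y| <= B + N%:R * d.
Proof.
move=> h0 rd rB.
have H (k : nat) : (k <= N)%N -> forall w : 'rV[R]_N,
    (forall i : 'I_N, (i < k)%N -> 0 <= w 0 i < M%:R) ->
    (forall i : 'I_N, (k <= i)%N -> exists2 p, (p <= M)%N & w 0 i = p%:R) ->
    `|r (z + h *: w)| <= B + k%:R * d.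
  elim: k => [|k IH] kN w w1 w2.
    have /choice[p pP] : forall i, exists p, (p <= M)%N /\ w 0 i = p%:R.
      by move=> i; have [p] := w2 i isT; exists p.
    have -> : w = natrv R p by apply/rowP => i; rewrite mxE (pP i).2.
    by rewrite mul0r addr0; apply: rB => m; have [] := pP m.
  pose i0 := Ordinal kN; have /andP[wi0 wiM] := w1 i0 (ltnSn k).
  pose q := Num.truncn (w 0 i0); have /andP[q1 q2] := truncn_itv wi0.
  (* Strictness matters: both neighbours [q] and [q.+1] must stay in the lattice cube. *)
  have qM : (q < M)%N by rewrite -(ltr_nat R); exact: le_lt_trans q1 wiM.
  pose w' := (\row_i if i == i0 then q%:R else w 0 i : R) : 'rV[R]_N.
  pose t := w 0 i0 - q%:R.
  have t01 : 0 <= t <= 1 by move: q1 q2; rewrite -/q -natr1 /t; lra.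
  have ww' : w = w' + t *: evec R i0.
    apply/rowP => i; rewrite !mxE eqxx /=; have [->|_] := eqVneq i i0;
      rewrite /= ?mulr1 ?mulr0 ?addr0 // /t.
    by rewrite addrC subrK.
  have H' (x : 'rV[R]_N) : (forall i, i != i0 -> x 0 i = w 0 i) ->
      (exists2 p, (p <= M)%N & x 0 i0 = p%:R) ->
        `|r (z + h *: x)| <= B + k%:R * d.
    move=> x1 x2; apply: IH => [|i ik|i ik]; first exact: ltnW.
      rewrite x1; last by apply/eqP => ii; move: ik; rewrite ii ltnn.
      by apply: w1; exact: ltnW.
    have [->//|ii] := eqVneq i i0; rewrite x1 //; apply: w2.
    rewrite ltn_neqAle ik andbT; apply: contra ii => /eqP kk.
    by apply/eqP/val_inj.
  have h1 : `|r (z + h *: w')| <= B + k%:R * d.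
    by apply: H' => [i /negPf ii|]; rewrite ?mxE ?ii ?eqxx //; exists q => //;
      exact: ltnW.
  have h2 : `|r (z + h *: w' + h *: evec R i0)| <= B + k%:R * d.
    rewrite -addrA -scalerDr; apply: H' => [i /negPf ii|].
      by rewrite !mxE ii andbF addr0.
    by exists q.+1 => //; rewrite !mxE !eqxx /= natr1.
  have := rd (z + h *: w') i0 t t01.
  have -> : z + h *: w' + (t * h) *: evec R i0 = z + h *: w.
    by rewrite ww' scalerDr scalerA mulrC addrA.
  move: (r _) (r _) (r _) h1 h2 => u r' v h1 h2 h3.
  have h4 : `|(1 - t) * v + t * r'| <= B + k%:R * d.
    apply: le_trans (ler_normD _ _) _; case/andP: t01 => t0 t1.
    rewrite !normrM (ger0_norm t0) ger0_norm ?subr_ge0 //; nra.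
  rewrite -natr1 mulrDl mul1r -[X in `|X|](subrK ((1 - t) * v + t * r')).
  by apply: le_trans (ler_normD _ _) _; lra.
move=> y yz; pose w := h^-1 *: (y - z).
have -> : y = z + h *: w by rewrite /w scalerA divff ?gt_eqF // scale1r addrC
    subrK.
apply: H => // i; last by rewrite leqNgt ltn_ord.
move=> _; have /andP[y1 y2] := yz i; rewrite !mxE; apply/andP; split.
  by rewrite mulr_ge0 ?invr_ge0 ?(ltW h0) // subr_ge0.
by rewrite mulrC ltr_pdivrMr // mulrC; lra.
Qed.

(** Discrete Taylor expansion at [z]. The remainder has vanishing value, first and second
    differences at [z], so three lattice walks integrate the bound on third differences, each
    costing a factor [N * M]; interpolation between lattice points adds [N K h^2]. *)
Lemma quad_fit f (K h e : R) M z : 0 <= K -> 0 < h -> 0 <= e -> C11 K f ->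
  (forall i k l p, (forall m, p m <= M)%N ->
    `|diff3 f (h *: evec R i) (h *: evec R k) (h *: evec R l)
        (z + h *: natrv R p)| <= e * h ^+ 2) ->
  exists c g S, symmx S /\
    forall y, (forall i, z 0 i <= y 0 i < z 0 i + h * M%:R) ->
    `|f y - quad c g S (y - z)| <= ((N * M)%:R ^+ 3 * e + N%:R * K) * h ^+ 2.
Proof.
move=> K0 h0 e0 fK f3.
pose S : 'M[R]_N :=
  \matrix_(i, k) (diff2 f (h *: evec R i) (h *: evec R k) z / h ^+ 2).
have hn : h != 0 by rewrite gt_eqF.
have Ss : symmx S by apply/matrixP => i k; rewrite !mxE diff2C.
(* The correction by half of [h * S i i] makes the polynomial agree with [f] at each
   [z + h *: evec R i]. *)
pose g : 'rV[R]_N :=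
  \row_i ((f (z + h *: evec R i) - f z) / h - 2^-1 * h * S i i).
exists (f z), g, S; split => //.
pose Q x := quad (f z) g S (x - z).
pose r x := f x - Q x.
have r2 a b x : diff2 r a b x = diff2 f a b x - dot (a *m S) b.
  by rewrite -(@diff2_quad (f z) g S z x a b Ss) /diff2 /r /Q; ring.
have S2 i k : dot (h *: evec R i *m S) (h *: evec R k) =
    diff2 f (h *: evec R i) (h *: evec R k) z.
  by rewrite dot_evec mxE; field.
have Qz : Q z = f z by rewrite /Q /quad subrr !dot0r mulr0 !addr0.
have rz : r z = 0 by rewrite /r Qz subrr.
pose B : R := (N * M)%:R.
have B0 : 0 <= B by rewrite ler0n.
have eh0 : 0 <= e * h ^+ 2 by rewrite mulr_ge0 ?sqr_ge0.
have w2 i k p : (forall m, p m <= M)%N ->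
    `|diff2 r (h *: evec R i) (h *: evec R k) (z + h *: natrv R p)| <=
      B * (e * h ^+ 2).
  apply: (lattice_walk (F := diff2 r (h *: evec R i) (h *: evec R k))) => //.
    by rewrite r2 S2 subrr.
  move=> q l qM; rewrite !r2; have := f3 i k l q qM; rewrite /diff3.
  by rewrite opprB addrA subrK.
have w1 i p : (forall m, p m <= M)%N ->
    `|r (z + h *: natrv R p + h *: evec R i) - r (z + h *: natrv R p)|
      <= B * (B * (e * h ^+ 2)).
  apply: (lattice_walk (F := fun x => r (x + h *: evec R i) - r x)) => //.
  - by rewrite mulr_ge0.
  - rewrite rz subr0 /r /Q /quad (addrAC z _ (- z)) subrr add0r dot_evec dotZr.
    by rewrite dot_evecr mxE; field.
  - move=> q k qM; have := w2 k i q qM; rewrite /diff2.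
    by congr (`|_| <= _); ring.
have w0 p : (forall m, p m <= M)%N ->
    `|r (z + h *: natrv R p)| <= B * (B * (B * (e * h ^+ 2))).
  apply: lattice_walk => [|//|q i]; last exact: w1.
  by apply: mulr_ge0 => //; exact: mulr_ge0.
have -> : (B ^+ 3 * e + N%:R * K) * h ^+ 2 =
    B * (B * (B * (e * h ^+ 2))) + N%:R * (K * h ^+ 2) by ring.
apply: (lattice_fill (r := r)) w0 => // x i t t01.
have := fK x (x + h *: evec R i) t t01.
have -> : (1 - t) *: x + t *: (x + h *: evec R i) = x + (t * h) *: evec R i.
  by apply/rowP => k; rewrite !mxE; ring.
have -> : normsq (x - (x + h *: evec R i)) = h ^+ 2.
  by rewrite normsqB addrAC subrr add0r normsqZ normsq_evec mulr1.
have Sii : `|S i i * h ^+ 2| <= K * (2 * h ^+ 2).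
  rewrite mxE divfK ?expf_neq0 //; apply: le_trans (diff2_le _ _ _ fK) _.
  by rewrite normsqZ normsq_evec; lra.
rewrite /r /Q !quad_evec // -/(Q x).
move: (f (x + (t * h) *: _)) (f (x + h *: _)) (f x) (Q x).
move: (_ + (_ *m _) _ _) => L u w' v q0 h1.
(* Linear interpolation is exact on the affine part, so the polynomial contributes only its square
   term, which [Sii] bounds by the same amount as the error of [f]. *)
have -> : u - (q0 + t * h * L + (t * h) ^+ 2 * (2^-1 * S i i)) -
   ((1 - t) * (v - q0) + t * (w' - (q0 + h * L + h ^+ 2 * (2^-1 * S i i)))) =
   (u - ((1 - t) * v + t * w')) +
     2^-1 * (t * (1 - t)) * (S i i * h ^+ 2) by field.
have tt : 0 <= t * (1 - t) <= 2^-1 by nra.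
have Kh : 0 <= K * h ^+ 2 by rewrite mulr_ge0 ?sqr_ge0.
apply: le_trans (ler_normD _ _) _; rewrite [X in _ + X]normrM ger0_norm;
  last by lra.
by nra.
Qed.

End QuadraticFit.

(** * Pigeonhole over scales and lattice points *)

Section GoodScale.
Set Implicit Arguments. Unset Strict Implicit.
Variables (R : realType) (N : nat) (f : 'rV[R]_N -> R) (K : R).
Hypothesis fK : C11 K f.
Hypothesis K0 : 0 <= K.
Implicit Types (i k l : 'I_N) (s e : R) (o y z : 'rV[R]_N).

Lemma evec_natrv i : evec R i = natrv R (fun m => (m == i : nat)).
Proof. by apply/rowP => m; rewrite !mxE. Qed.

(** The base point is shifted by the first step because the polarization identity controls the third
    difference only at such a translate. *)
Definition scaled_diff3 s j i k l y : R :=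
  diff3 f (((2 ^ j)%:R * s) *: evec R i) (((2 ^ j)%:R * s) *: evec R k)
    (((2 ^ j)%:R * s) *: evec R l) (y + ((2 ^ j)%:R * s) *: evec R i) / 4 ^+ j.

(* [900 = 3/4 * 3 * 16 * 5^2]: the polarization identity, its three terms, the
   energy bound, and [|diff2| <= 5 K s^2] for the directions used. *)
Lemma sum_boxsum_scaled_diff3 o s i k l J n :
  \sum_(j < J) boxsum o s n (fun y => scaled_diff3 s j i k l y ^+ 2)
  <= 900 * K ^+ 2 * s ^+ 4 * (n + 2 ^ (J + 3))%:R ^+ N.
Proof.
pose u m : 'I_N -> nat := fun x => (x == m : nat).
pose w : 'I_N -> nat := fun x => (u i x + u k x)%N.
pose D c j y : R := (diff3 f ((2 ^ j)%:R *: (s *: natrv R c))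
  ((2 ^ j)%:R *: (s *: natrv R (u l))) ((2 ^ j)%:R *: (s *: natrv R c)) y
  / 4 ^+ j) ^+ 2.
have u1 m x : (u m x <= 1)%N by rewrite /u; case: eqP.
have nu m : normsq (natrv R (u m)) = 1 by rewrite -evec_natrv normsq_evec.
have D0 c j y : 0 <= D c j y by exact: sqr_ge0.
have bnd c n' : (forall x, c x <= 2)%N -> normsq (natrv R c) <= 4 ->
    \sum_(j < J) boxsum o s n' (D c j) <=
    400 * K ^+ 2 * s ^+ 4 * (n' + 2 ^ (J + 2))%:R ^+ N.
  move=> c2 nc; have := @sum_boxsum_diff3 R N f o s c (u l) _ (K * (5 * s ^+
    2)) J n'.
  have -> : 16 * ((K * (5 * s ^+ 2)) ^+ 2 * (n' + 2 ^ (J + 2))%:R ^+ N) =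
    400 * K ^+ 2 * s ^+ 4 * (n' + 2 ^ (J + 2))%:R ^+ N :> R by ring.
  apply=> [x|y]; first by have := c2 x; have := u1 l x; lia.
  apply: le_trans (diff2_le _ _ _ fK) _; rewrite ler_wpM2l // !normsqZ nu.
  by have := sqr_ge0 s; nra.
have pw (j : 'I_J) y : scaled_diff3 s j i k l y ^+ 2 <=
    3 / 4 * (D w j y + D (u i) j y
      + D (u k) j (y + s *: natrv R (fun x => 2 ^ j * 2 * u i x)%N)).
  rewrite /scaled_diff3 /D.
  have := diff3_polarization f ((2 ^ j)%:R *: (s *: natrv R (u i)))
    ((2 ^ j)%:R *: (s *: natrv R (u l))) ((2 ^ j)%:R *: (s *: natrv R (u k))) y.
  have -> : y + (2 ^ j)%:R *: (s *: natrv R (u i)) +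
      (2 ^ j)%:R *: (s *: natrv R (u i))
     = y + s *: natrv R (fun x => 2 ^ j * 2 * u i x)%N.
    by apply/rowP => x; rewrite !mxE !natrM; ring.
  have -> : (2 ^ j)%:R *: (s *: natrv R (u i)) +
      (2 ^ j)%:R *: (s *: natrv R (u k))
     = (2 ^ j)%:R *: (s *: natrv R w).
    by rewrite /w natrvD !scalerDr.
  rewrite !evec_natrv -!scalerA.
  set T := (X in 2 * X = _); set A := (X in _ = X - _ - _).
  set B := (X in _ = _ - X - _); set C := (X in _ = _ - _ - X) => TT.
  rewrite -/(u i) -/(u k) -/(u l) -/T -/A -/B -/C;
    move: T A B C TT => T A B C TT.
  rewrite !expr_div_n -!mulrDl mulrA ler_pM2r ?invr_gt0 ?exprn_gt0 //.
  suff : 0 <= 3 * (A ^+ 2 + B ^+ 2 + C ^+ 2) - 4 * T ^+ 2 by lra.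
  have -> : 4 * T ^+ 2 = (2 * T) ^+ 2 by ring.
  rewrite TT; set d := (X in 0 <= X).
  (* Sum of squares form of [(A - B - C)^2 <= 3 (A^2 + B^2 + C^2)]. *)
  have -> : d = (A + B) ^+ 2 + (A + C) ^+ 2 + (B - C) ^+ 2 by rewrite /d; ring.
  by rewrite !addr_ge0 ?sqr_ge0.
have h1 : \sum_(j < J) boxsum o s n (fun y => scaled_diff3 s j i k l y ^+ 2) <=
   3 / 4 * (\sum_(j < J) boxsum o s n (D w j) +
     \sum_(j < J) boxsum o s n (D (u i) j)
    + \sum_(j < J) boxsum o s (n + 2 ^ (J + 1)) (D (u k) j)).
  rewrite -!big_split /= mulr_sumr; apply: ler_sum => j _.
  apply: le_trans (le_boxsum _ _ _ (pw j)) _; rewrite boxsumZ !boxsumD.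
  rewrite ler_pM2l ?lerD2l; last by lra.
  apply: le_boxsum_shift => [y|x]; first exact: D0.
  rewrite addnC leq_add2l -[leqRHS]muln1 leq_mul // -expnSr addn1 leq_exp2l //.
  by rewrite ltnS ltnW.
have nw : normsq (natrv R w) <= 4.
  by rewrite /w natrvD; apply: le_trans (normsqD_le _ _) _; rewrite !nu; lra.
have := bnd w n (fun x => leq_add (u1 _ _) (u1 _ _)) nw.
have u2 m x : (u m x <= 2)%N by exact: leq_trans (u1 m x) _.
have nu4 m : normsq (natrv R (u m)) <= 4 by rewrite nu; lra.
have := bnd (u i) n (u2 i) (nu4 i).
have := bnd (u k) (n + 2 ^ (J + 1))%N (u2 k) (nu4 k) => b1 b2 b3.
pose T : R := 400 * K ^+ 2 * s ^+ 4 * (n + 2 ^ (J + 3))%:R ^+ N.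
have bT n' : (n' <= n + 2 ^ (J + 3))%N ->
    400 * K ^+ 2 * s ^+ 4 * n'%:R ^+ N <= T.
  move=> nn'; apply: ler_wpM2l; last by apply: lerXn2r;
    rewrite ?nnegrE ?ler0n ?ler_nat.
  by apply: mulr_ge0; [apply: mulr_ge0;
    [exact: ler0n|exact: sqr_ge0]|exact: exprn_even_ge0].
(* The width absorbs both the translation of the third polarization term, at most [2 ^ (J + 1)], and
   the widening in the energy bound. *)
have p1 : (n + 2 ^ (J + 1) + 2 ^ (J + 2) <= n + 2 ^ (J + 3))%N.
  by rewrite !expnD; lia.
have p2 : (n + 2 ^ (J + 2) <= n + 2 ^ (J + 3))%N by rewrite !expnD; lia.
have b1' := le_trans b1 (bT _ p1).
have b2' := le_trans b2 (bT _ p2).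
have b3' := le_trans b3 (bT _ p2).
apply: le_trans h1 _.
have -> : 900 * K ^+ 2 * s ^+ 4 * (n + 2 ^ (J + 3))%:R ^+ N =
    3 / 4 * (T + T + T).
  by rewrite /T; field.
by rewrite ler_pM2l ?lerD //; lra.
Qed.

(** If every block of every scale contained a large third difference, the squares would add up to at
    least [J e^2 #|X| s^4], more than the energy bound summed over the [N^3] directions and the
    offsets in a block. The corner [c j x] of the block of [x] may depend on the scale. *)
Lemma good_scale o s e (J W nb : nat) (X : finType)
    (c : nat -> X -> 'I_N -> nat) :
  0 < s -> 0 < e ->
  (forall j x i, (j < J)%N -> (c j x i < nb)%N) ->
  (forall j x x', (j < J)%N -> c j x =1 c j x' -> x = x') ->
  900 * K ^+ 2 * (N * N * N * W.+1 ^ N)%:R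
      * (nb + 2 ^ J * W + 2 ^ (J + 3))%:R ^+ N
    < J%:R * (e ^+ 2 * #|X|%:R) ->
  exists j x, (j < J)%N /\ forall i k l p, (forall m, p m <= W)%N ->
   `|scaled_diff3 s j i k l
       (o + s *: natrv R (c j x) + ((2 ^ j)%:R * s) *: natrv R p)|
     <= e * s ^+ 2.
Proof.
move=> s0 e0 cnb cinj; apply: contraPP => /forallNP bad; apply/negP;
  rewrite -leNgt.
pose P := {ffun 'I_N -> 'I_W.+1}.
pose T j x (ikl : 'I_N * 'I_N * 'I_N) (p : P) : R :=
  scaled_diff3 s j ikl.1.1 ikl.1.2 ikl.2
  (o + s *: natrv R (c j x) + ((2 ^ j)%:R * s) *: natrv R (fun m => p m)) ^+ 2.
have T0 j x ikl p : 0 <= T j x ikl p by exact: sqr_ge0.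
have lower : J%:R * (e ^+ 2 * #|X|%:R) * s ^+ 4 <=
    \sum_(j < J) \sum_x \sum_ikl \sum_p T j x ikl p.
  have -> : J%:R * (e ^+ 2 * #|X|%:R) * s ^+ 4 =
      \sum_(j < J) \sum_(x : X) e ^+ 2 * s ^+ 4.
    rewrite !sumr_const card_ord -[RHS]mulr_natl -[X in _ = _ * X]mulr_natl;
      ring.
  apply: ler_sum => j _; apply: ler_sum => x _.
  have [i [k [l [p [pW]]]]] : exists i k l p, (forall m, p m <= W)%N /\
      e * s ^+ 2 < `|scaled_diff3 s j i k l
       (o + s *: natrv R (c j x) + ((2 ^ j)%:R * s) *: natrv R p)|.
    apply: contrapT => H; have /forallNP/(_ x) := bad j; apply;
      split => // i k l p pW.
    rewrite leNgt; apply/negP => H'; apply: H; by exists i, k, l, p.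
  pose p' : P := [ffun m => inord (p m)].
  have pp' : p = (fun m => p' m : nat).
    by apply/funext => m; rewrite ffunE inordK // ltnS.
  rewrite pp' => lt; rewrite (bigD1 (i, k, l)) //= (bigD1 p') //= -addrA.
  apply: le_trans (_ : T j x (i, k, l) p' <= _).
    rewrite /T /= -[leRHS]real_normK ?num_real //.
    have -> : e ^+ 2 * s ^+ 4 = (e * s ^+ 2) ^+ 2 by ring.
    by rewrite ler_pXn2r ?nnegrE ?normr_ge0 ?(ltW lt) // mulr_ge0 ?sqr_ge0
      ?(ltW e0).
  rewrite lerDl addr_ge0 // ?sumr_ge0 // => a _; exact: sumr_ge0.
(* Blocks may overlap, but for a fixed offset [p] distinct [x] give distinct lattice points, so a
   single cube bounds the sum over [x]. *)
have upper ikl p : \sum_(j < J) \sum_x T j x ikl p <=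
    900 * K ^+ 2 * s ^+ 4 * (nb + 2 ^ J * W + 2 ^ (J + 3))%:R ^+ N.
  apply: le_trans (sum_boxsum_scaled_diff3 o s ikl.1.1 ikl.1.2 ikl.2 J (nb +
    2 ^ J * W)).
  apply: ler_sum => j _.
  set G := (fun y => _ ^+ 2); have G0 y : 0 <= G y by exact: sqr_ge0.
  have sh m : (2 ^ j * p m + nb <= nb + 2 ^ J * W)%N.
    rewrite addnC leq_add2l; apply: leq_mul; last by rewrite -ltnS.
    by rewrite leq_exp2l // ltnW.
  apply: le_trans (le_boxsum_shift o s G0 sh).
  pose h x : {ffun 'I_N -> 'I_nb} :=
    [ffun i => Ordinal (@cnb j x i (ltn_ord j))].
  have hi : injective h.
    move=> x x' /ffunP hx; apply: (cinj j) => // i.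
    by have /(congr1 val) := hx i; rewrite !ffunE.
  apply: le_trans (ler_sum_inj hi _) => //=; apply: ler_sum => x _.
  rewrite /T /G le_eqVlt; apply/orP; left; apply/eqP;
    congr (scaled_diff3 _ _ _ _ _ _ ^+ 2).
  congr (_ + _ *: _ + _); first by apply/rowP => i; rewrite !mxE ffunE.
  by rewrite natrvM scalerA mulrC.
have s4 : 0 < s ^+ 4 by rewrite exprn_gt0.
rewrite -(ler_pM2r s4); apply: le_trans lower _.
have -> : \sum_(j < J) \sum_x \sum_ikl \sum_p T j x ikl p =
    \sum_ikl \sum_p \sum_(j < J) \sum_x T j x ikl p.
  under eq_bigr do rewrite exchange_big /=.
  rewrite exchange_big /=; apply: eq_bigr => ikl _.
  under eq_bigr do rewrite exchange_big /=.
  by rewrite exchange_big.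
apply: le_trans (ler_sum _ (fun ikl _ => ler_sum _ (fun p _ => upper ikl p))) _.
rewrite !sumr_const !card_prod card_ffun !card_ord -mulrnA -mulr_natl.
by rewrite (mulnC (_ ^ _)%N) le_eqVlt; apply/orP; left; apply/eqP; ring.
Qed.

End GoodScale.

(** * Quadratic approximation near some point of a set of positive density *)

Section QuadraticApproximation.
Set Implicit Arguments. Unset Strict Implicit.
Variables (R : realType) (N : nat) (f : 'rV[R]_N -> R) (K : R).
Hypothesis fK : C11 K f.
Hypothesis K0 : 0 <= K.

Lemma exists_nat_gt (x : R) : exists n : nat, x < n%:R.
Proof.
have [x0|x0] := leP 0 x; last by exists 0%N.
by exists (Num.truncn x).+1; have /andP[] := truncn_itv x0.
Qed.

(** The set [E] provides at least [(c0 / s)^N] separated points, while the lattice cube has at most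
    [(4 L / s)^N] points. The powers of [s] cancel in the pigeonhole, so a large number of scales
    suffices. *)
Lemma exists_quad_approx (E : set 'rV[R]_N) (L c0 s0 : R) :
  0 < L -> 0 < c0 -> 0 < s0 ->
  (forall s, 0 < s -> s < s0 ->
    exists n (x : {ffun 'I_N -> 'I_n} -> 'rV[R]_N),
    [/\ c0 <= n%:R * s, forall k, E (x k) /\ `|x k| <= L
      & forall k k', k != k' -> s < `|x k - x k'|]) ->
  forall eta rho0 : R, 0 < eta -> 0 < rho0 ->
  exists x rho c g S z, [/\ E x, 0 < rho < rho0, symmx S
    & forall y, `|y - x| <= rho ->
      `|f y - quad c g S (y - z)| <= eta * rho ^+ 2].
Proof.
move=> L0 c00 s00 dense eta rho0 eta0 rho00.
(* The ball has radius [m1] cells, so that the interpolation error [N K h^2], plus [h^2] for the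
   third differences, is at most [eta * (m1 h)^2]. *)
have [m1 m1P] : exists m1 : nat, (0 < m1)%N /\ N%:R * K + 1 <= eta * m1%:R ^+ 2.
  have [n nP] := exists_nat_gt ((N%:R * K + 1) / eta).
  exists n.+1; split => //; move: nP; rewrite ltr_pdivrMr // -natr1.
  have : 0 <= n%:R :> R by []; nra.
case: m1P => m1_gt0 m1P.
(* A cube of [M] cells contains the ball, with room for rounding its centre to the lattice; [W] has
   one cell more because of the shifted base point in [scaled_diff3]. *)
pose m := m1.+1; pose M := (2 * m)%N; pose W := M.+1.
pose e : R := ((N * M)%:R ^+ 3 + 1)^-1.
have NM0 : 0 <= (N * M)%:R ^+ 3 :> R by rewrite exprn_ge0.
have e0 : 0 < e by rewrite invr_gt0; lra.
have eM : (N * M)%:R ^+ 3 * e <= 1.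
  by rewrite /e ler_pdivrMr; lra.
have [C CE] : exists C : R, 900 * K ^+ 2 * (N * N * N * W.+1 ^ N)%:R = C.
  by eexists.
have C0 : 0 <= C.
  rewrite -CE; apply: mulr_ge0; last exact: ler0n.
  by apply: mulr_ge0; [exact: ler0n|exact: sqr_ge0].
(* The number [J] of scales only depends on the density of the points, not on
   the lattice spacing [s], which is chosen afterwards. *)
have [J JP] := exists_nat_gt (C * (4 * L) ^+ N / (e ^+ 2 * c0 ^+ N)).
have ec0 : 0 < e ^+ 2 * c0 ^+ N by rewrite mulr_gt0 // exprn_gt0.
rewrite ltr_pdivrMr // in JP.
(* Dividing by [A] keeps every block smaller than [L] and every ball radius below [rho0], at all
   scales [j < J]. *)
pose A : R := (2 ^ J)%:R * (W + 8 + m)%:R + 2.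
have A0 : 2 <= A by rewrite /A lerDr mulr_ge0.
pose s := Num.min (Num.min s0 rho0) L / A.
have min0 : 0 < Num.min (Num.min s0 rho0) L by rewrite !lt_min s00 rho00 L0.
have sgt0 : 0 < s by rewrite divr_gt0 //; lra.
have sA : s * A <= s0 /\ s * A <= rho0 /\ s * A <= L.
  rewrite /s divfK; last by rewrite gt_eqF //; lra.
  by rewrite !ge_min !lexx /= !orbT.
case: sA => sAs [sAr sAL].
have s1 : s < s0 by nra.
have [n [x [nc xE xsep]]] := dense s sgt0 s1.
(* The points have norm at most [L]; the origin at [- 2 L] leaves room for the subtraction of
   [m * 2 ^ j] in [c], which is truncated otherwise. *)
pose o : 'rV[R]_N := const_mx (- (2 * L)).
pose tr k i := Num.truncn ((x k 0 i + 2 * L) / s).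
pose c (j : nat) k i := (tr k i - m * 2 ^ j)%N.
pose nb := (Num.truncn (3 * L / s)).+1.
have xL k i : - L <= x k 0 i <= L.
  by have := le_trans (coord_le_norm (x k) 0 i) (xE k).2; rewrite ler_norml.
have trP k i : (tr k i)%:R <= (x k 0 i + 2 * L) / s < (tr k i).+1%:R.
  by apply: truncn_itv; rewrite divr_ge0 ?(ltW sgt0) //; have := xL k i; lra.
have trP1 k i : s * (tr k i)%:R <= x k 0 i + 2 * L < s * (tr k i)%:R + s.
  by have := trP k i; rewrite ler_pdivlMr // ltr_pdivrMr // -natr1; lra.
have pow j : (j < J)%N -> (2 ^ j)%:R <= (2 ^ J)%:R :> R.
  by move=> jJ; rewrite ler_nat leq_exp2l // ltnW.
have pow1 j : 1 <= (2 ^ j)%:R :> R by rewrite ler1n expn_gt0.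
have sP : (2 ^ J)%:R * s * (W + 8 + m)%:R + 2 * s <= L.
  by move: sAL; rewrite /A; lra.
have tr_ge j k i : (j < J)%N -> (m * 2 ^ j <= tr k i)%N.
  move=> jJ; rewrite -ltnS -(ltr_nat R) -(ltr_pM2l sgt0).
  have := trP1 k i; have := xL k i; rewrite -natr1 natrM.
  rewrite natrD in sP.
  have h1 : 0 <= (2 ^ J)%:R * s * (W + 8)%:R.
    by rewrite mulr_ge0 ?ler0n // mulr_ge0 ?ler0n // ltW.
  have h2 : m%:R * (s * (2 ^ j)%:R) <= m%:R * (s * (2 ^ J)%:R).
    by rewrite ler_wpM2l // ler_pM2l // pow.
  by lra.
have cE j k i : (j < J)%N ->
    (c j k i)%:R = (tr k i)%:R - m%:R * (2 ^ j)%:R :> R.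
  by move=> jJ; rewrite /c natrB ?tr_ge // natrM.
have [|||j [k [jJ good]]] := @good_scale R N f K fK K0 o s e J W nb _ c sgt0 e0.
- move=> j k i jJ; apply: leq_ltn_trans (leq_subr _ _) _; rewrite /nb ltnS.
  apply: le_truncn; rewrite ler_pM2r ?invr_gt0 //.
  by have := xL k i; lra.
- move=> j k k' jJ ckk'; apply/eqP; apply: contraPT (xsep k k') => kk'.
  move=> /(_ kk'); apply/negP; rewrite -leNgt; apply: norm_rV_le => [|i];
    first exact: ltW.
  have : (tr k i) = (tr k' i).
    rewrite -[LHS](subnK (tr_ge j k i jJ)) -[RHS](subnK (tr_ge j k' i jJ)).
    by congr addn; exact: ckk'.
  have := trP1 k i; have := trP1 k' i; rewrite !mxE => h1 h2 h3.
  by rewrite h3 in h2; rewrite ler_norml; apply/andP; split; lra.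
- rewrite card_ffun !card_ord CE.
  set nt := (nb + _ + _)%N.
  have nts : nt%:R * s <= 4 * L.
    have nbE : nb%:R = (Num.truncn (3 * L / s))%:R + 1 :> R.
      by rewrite /nb -natr1.
    rewrite /nt !natrD natrM expnD natrM nbE -[(2 ^ 3)%N]/8%N.
    have h : (Num.truncn (3 * L / s))%:R * s <= 3 * L.
      have L3 : 0 <= 3 * L / s by rewrite divr_ge0 ?(ltW sgt0) //; lra.
      have /andP[+ _] := truncn_itv L3.
      by rewrite ler_pdivlMr.
    have : 0 <= m%:R * ((2 ^ J)%:R * s).
      by rewrite mulr_ge0 ?ler0n // mulr_ge0 ?ler0n // ltW.
    by move: sP; rewrite !natrD; lra.
  have sN : 0 < s ^+ N by rewrite exprn_gt0.
  (* Multiplication by [s ^+ N] turns the point counts into [(4 L)^N] and [c0^N], independent of the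
     spacing. *)
  rewrite -(ltr_pM2r sN) -!mulrA -exprMn natrX -exprMn.
  apply: le_lt_trans (_ : C * (4 * L) ^+ N < _).
    apply: ler_wpM2l => //; apply: lerXn2r => //; rewrite nnegrE.
      by apply: mulr_ge0; [exact: ler0n|exact: ltW].
    by apply: mulr_ge0; [exact: ler0n|exact: ltW].
  apply: lt_le_trans JP _; apply: ler_wpM2l; first exact: ler0n.
  rewrite mulrA -expr2; apply: ler_wpM2l; first exact: sqr_ge0.
  apply: lerXn2r => //; rewrite nnegrE; first exact: ltW.
  by apply: mulr_ge0; [exact: ler0n|exact: ltW].
pose h : R := (2 ^ j)%:R * s.
have h0 : 0 < h by rewrite mulr_gt0 // ltr0n expn_gt0.
(* The extra [h] in each coordinate compensates the shift in [scaled_diff3]: a base point [z + h p]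
   is reached from the offset [p + 1] minus the unit vector of the first direction. *)
pose z := o + s *: natrv R (c j k) + h *: natrv R (fun=> 1%N).
have [|c' [g [S [Ss fit]]]] := @quad_fit R N f K h e M z K0 h0 (ltW e0) fK.
  move=> i k' l p pM.
  pose p' a := (p a + 1 - (a == i))%N.
  have p'W a : (p' a <= W)%N.
    by apply: leq_trans (leq_subr _ _) _; rewrite addn1 ltnS.
  have := good i k' l p' p'W; rewrite /scaled_diff3 -/h.
  have -> : o + s *: natrv R (c j k) + h *: natrv R p' + h *: evec R i =
      z + h *: natrv R p.
    rewrite /z -!addrA -!scalerDr; congr (_ + (_ + _ *: _)).
    rewrite -natrvS -natrvD; congr natrv; apply/funext => a.
    by rewrite /p' subnK ?(addnC 1%N) // addn1; case: eqP.
  rewrite normrM normfV [`|4 ^+ j|]ger0_norm ?exprn_ge0 // ler_pdivrMr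
    ?exprn_gt0 //.
  have -> : e * h ^+ 2 = e * s ^+ 2 * 4 ^+ j; last by [].
  have -> : 4 ^+ j = (2 ^ j)%:R ^+ 2 :> R.
    by rewrite natrX -exprM mulnC exprM; congr (_ ^+ j); ring.
  by rewrite /h; ring.
exists (x k), (h * m1%:R), c', g, S, z; split => //.
- by have [] := xE k.
- apply/andP; split; first by rewrite mulr_gt0 // ltr0n.
  apply: lt_le_trans sAr; rewrite /h /A /m !natrD -natr1.
  have h4 := pow _ jJ; have h1 := pow1 J.
  have h2 : 0 < m1%:R :> R by rewrite ltr0n.
  have h3 : 0 <= W%:R :> R by [].
  have : (2 ^ j)%:R * s * m1%:R <= s * ((2 ^ J)%:R * m1%:R).
    by rewrite -mulrA mulrCA ler_wpM2l ?(ltW sgt0) // ler_wpM2r // ltW.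
  have : 0 <= s * ((2 ^ J)%:R * W%:R) by rewrite mulr_ge0 ?(ltW sgt0) //
      mulr_ge0 ?ler0n.
  have : 0 < s * (2 ^ J)%:R by rewrite mulr_gt0 //; lra.
  by lra.
- move=> y yx; apply: le_trans (fit y _) _.
    move=> i; have := coord_le_norm (y - x k) 0 i; move/le_trans/(_ yx).
    have mE : m%:R = m1%:R + 1 :> R by rewrite /m -natr1.
    rewrite !mxE ler_norml cE // /M natrM mE => /andP[y1 y2].
    have /andP[t1 t2] := trP1 k i.
    have sh : s <= h by rewrite /h; have := pow1 j; nra.
    have -> : s * ((tr k i)%:R - (m1%:R + 1) * (2 ^ j)%:R) =
        s * (tr k i)%:R - h * (m1%:R + 1).
      by rewrite /h; ring.
    by apply/andP; split; lra.
  rewrite [leRHS](_ : _ = (eta * m1%:R ^+ 2) * h ^+ 2); last by ring.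
  by rewrite ler_wpM2r ?sqr_ge0 //; lra.
Qed.

End QuadraticApproximation.

(** * Quadratic test functions *)

Section QuadraticJets.
Set Implicit Arguments. Unset Strict Implicit.
Variables (R : realType) (N : nat).
Implicit Types (f u v : 'rV[R]_N -> R) (x y z g : 'rV[R]_N) (S : 'M[R]_N).

Lemma is_derive_quadratic f x w (a b : R) :
  (forall t : R, f (x + t *: w) = f x + t * a + t ^+ 2 * b) ->
  is_derive x w f a.
Proof.
move=> fq.
have H : (fun t : R => t^-1 *: ((f \o shift x) (t *: w) - f x)) @ 0^' --> a.
  have : (fun t : R => a + t * b) @ 0^' --> a + 0 * b.
    apply: cvgD; first exact: cvg_cst.
    apply: cvgM; last exact: cvg_cst.
    exact: nbhs_dnbhs.
  rewrite mul0r addr0; apply: cvg_trans; apply: near_eq_cvg.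
  near=> t; rewrite /= [t *: w + x]addrC fq.
  have t0 : t != 0 by near: t; exact: nbhs_dnbhs_neq.
  by rewrite /GRing.scale /=; field.
by split; [apply/cvg_ex; exists a|exact: cvg_lim H].
Unshelve. all: by end_near. Qed.

Lemma coord_sub_continuous z i : continuous (fun y : 'rV[R]_N => (y - z) 0 i).
Proof.
move=> y; rewrite (_ : (fun _ => _) =
  (fun y : 'rV[R]_N => y 0 i) - cst (z 0 i)).
  by apply: continuousB; [exact: coord_continuous|exact: cst_continuous].
by apply/funext => y'; rewrite !mxE.
Qed.

Lemma dot_continuous (T : topologicalType) (F G : T -> 'rV[R]_N) :
  (forall i, continuous (fun t => F t 0 i)) ->
  (forall i, continuous (fun t => G t 0 i)) ->
  continuous (fun t => dot (F t) (G t)).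
Proof.
move=> Fc Gc; apply: continuous_big => [|i _ t].
  exact: add_continuous.
by apply: continuousM; [exact: Fc|exact: Gc].
Qed.

Lemma mulmx_sub_continuous S z i : continuous (fun y => ((y - z) *m S) 0 i).
Proof.
rewrite (_ : (fun _ => _) = (fun y => dot (y - z) (row i S^T))).
  apply: dot_continuous => k y; first exact: coord_sub_continuous.
  exact: cst_continuous.
by apply/funext => y; rewrite mxE; apply: eq_bigr => k _; rewrite !mxE.
Qed.

Lemma quad_continuous c g S z : continuous (fun y => quad c g S (y - z)).
Proof.
have h1 : continuous (fun y => dot g (y - z)).
  apply: (@dot_continuous _ (fun=> g)) => i; last exact: coord_sub_continuous.
  exact: cst_continuous.
have h2 : continuous (fun y => dot ((y - z) *m S) (y - z)).
  apply: dot_continuous => i; first exact: mulmx_sub_continuous.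
  exact: coord_sub_continuous.
move=> y; rewrite (_ : (fun y => _) = cst c + (fun y => dot g (y - z))
  + cst 2^-1 * (fun y => dot ((y - z) *m S) (y - z))) //.
apply: continuousD; first by apply: continuousD;
  [exact: cst_continuous|exact: h1].
by apply: continuousM; [exact: cst_continuous|exact: h2].
Qed.

Lemma pderiv_quad c g S z j : symmx S ->
  pderiv j (fun y => quad c g S (y - z)) = fun y => g 0 j + ((y - z) *m S) 0 j.
Proof.
move=> Ss; apply/funext => y.
apply: (@derive_val _ _ _ _ _ _ _ (is_derive_quadratic (b :=
  2^-1 * S j j) _)) => t.
exact: quad_evec.
Qed.

Lemma is_derive_pderiv_quad c g S z i j y : symmx S ->
  is_derive y (evec R i) (pderiv j (fun y => quad c g S (y - z))) (S i j).
Proof.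
move=> Ss; rewrite pderiv_quad //; apply: (is_derive_quadratic (b := 0)) => t.
rewrite (addrAC y _ (- z)) mulmxDl [in LHS]mxE -scalemxAl -rowE !mxE; ring.
Qed.

Lemma C2_quad c g S z U : symmx S -> C2_on U (fun y => quad c g S (y - z)).
Proof.
move=> Ss x _; split=> [|j|i j]; first exact: quad_continuous.
- split; first apply: (@ex_derive _ _ _ _ _ _ _
    (is_derive_quadratic (b := 2^-1 * S j j) _)) => t.
    exact: quad_evec.
  rewrite pderiv_quad // (_ : (fun y => _) =
    cst (g 0 j) + fun y => ((y - z) *m S) 0 j) //.
  apply: continuousD; first exact: cst_continuous.
  exact: mulmx_sub_continuous.
- split; first exact: (@ex_derive _ _ _ _ _ _ _ (is_derive_pderiv_quad _ _ _ _
    _ _ Ss)).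
  rewrite (_ : pderiv i _ = cst (S i j)); first exact: cst_continuous.
  apply/funext => y.
  exact: (@derive_val _ _ _ _ _ _ _ (is_derive_pderiv_quad _ _ _ _ _ _ Ss)).
Qed.

Lemma hessian_quad c g S z x : symmx S ->
  hessian (fun y => quad c g S (y - z)) x = S.
Proof.
move=> Ss; apply/matrixP => i j; rewrite mxE.
exact: (@derive_val _ _ _ _ _ _ _ (is_derive_pderiv_quad _ _ _ _ _ _ Ss)).
Qed.

Lemma superjet_quad u x (rho c : R) g S z : 0 < rho -> symmx S ->
  (forall y, `|y - x| < rho -> u y <= quad c g S (y - z)) ->
  u x = quad c g S (x - z) -> superjet u x (u x, S).
Proof.
move=> rho0 Ss uq ux; exists (fun y => quad c g S (y - z)), rho; split => //.
split; first exact: C2_quad.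
split; first by move=> y; rewrite -ball_normE /= distrC; exact: uq.
by split => //; rewrite hessian_quad // ux.
Qed.

Lemma subjet_quad v x (rho c : R) g S z : 0 < rho -> symmx S ->
  (forall y, `|y - x| < rho -> quad c g S (y - z) <= v y) ->
  v x = quad c g S (x - z) -> subjet v x (v x, S).
Proof.
move=> rho0 Ss vq vx; exists (fun y => quad c g S (y - z)), rho; split => //.
split; first exact: C2_quad.
split; first by move=> y; rewrite -ball_normE /= distrC; exact: vq.
by split => //; rewrite hessian_quad // vx.
Qed.

End QuadraticJets.

(** * Semicontinuous functions on compact sets *)

Section Semicontinuity.
Set Implicit Arguments. Unset Strict Implicit.
Variables (R : realType) (N : nat).

(** Stated on a general topological space so that it applies to products, where the doubled
    functionals are maximized. *)
Definition usc_in (T : topologicalType) (A : set T) (f : T -> R) :=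
  forall x, A x -> forall e : R, 0 < e ->
    \forall y \near x, A y -> f y < f x + e.

(** The superlevel sets at the values of [f] on [A] generate a proper filter, and any cluster point
    of it is a maximum. *)
Lemma usc_in_max (T : topologicalType) (A : set T) (f : T -> R) :
  compact A -> A !=set0 -> usc_in A f ->
  exists2 x, A x & forall y, A y -> f y <= f x.
Proof.
move=> Ac [a Aa] fA.
pose B z := [set y | A y /\ f z <= f y].
have FF : ProperFilter (filter_from A B).
  apply: filter_from_proper; last by move=> z Az; exists z; split.
  apply: filter_from_filter; first by exists a.
  move=> i j Ai Aj; have [ij|ij] := leP (f i) (f j).
    by exists j => // y [Ay fy]; split; split => //; exact: le_trans fy.
  by exists i => // y [Ay fy]; split; split => //; apply: le_trans fy;
    exact: ltW.
have [|x [Ax xcl]] := Ac _ FF; first by exists a => // y [].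
exists x => // y Ay; rewrite leNgt; apply/negP => xy.
have e0 : 0 < f y - f x by rewrite subr_gt0.
have [z [[Az yz] zn]] := xcl (B y) _ (ex_intro2 _ _ y Ay (@subset_refl _ _))
  (fA x Ax _ e0).
by have := zn Az; rewrite addrC subrK ltNge yz.
Qed.

Lemma usc_inD (T : topologicalType) (A : set T) (f g : T -> R) :
  usc_in A f -> usc_in A g -> usc_in A (fun x => f x + g x).
Proof.
move=> fA gA x Ax e e0; have e2 : 0 < e / 2 by rewrite divr_gt0.
have := fA x Ax _ e2; have := gA x Ax _ e2; apply: filterS2 => y h1 h2 Ay.
by have := h1 Ay; have := h2 Ay; lra.
Qed.

Lemma continuous_usc_in (T : topologicalType) (A : set T) (f : T -> R) :
  continuous f -> usc_in A f.
Proof.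
move=> fc x Ax e e0; have /cvgrPdist_lt/(_ e e0) := fc x.
by apply: filterS => y; rewrite ltr_norml => /andP[h1 h2] _; lra.
Qed.

Lemma usc_on_usc_in (T : topologicalType) (A : set T) (K : set 'rV[R]_N) u
    (h : T -> 'rV[R]_N) :
  usc_on K u -> continuous h -> (forall x, A x -> K (h x)) ->
  usc_in A (u \o h).
Proof.
move=> uK hc hK x Ax e e0; have [d [d0 dP]] := uK _ (hK _ Ax) e e0.
have /cvgrPdist_lt/(_ d d0) := hc x.
by apply: filterS => y; rewrite distrC => hy Ay; exact: dP (hK _ Ay) hy.
Qed.

Lemma lsc_on_usc_in (T : topologicalType) (A : set T) (K : set 'rV[R]_N) v
    (h : T -> 'rV[R]_N) :
  lsc_on K v -> continuous h -> (forall x, A x -> K (h x)) ->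
  usc_in A (fun x => - v (h x)).
Proof.
move=> vK; apply: (@usc_on_usc_in _ _ K (fun x => - v x)) => x Kx e e0.
have [d [d0 dP]] := vK x Kx e e0; exists d; split=> // y Ky yx.
by have := dP y Ky yx; lra.
Qed.

Lemma continuous_coord (T : topologicalType) (h : T -> 'rV[R]_N) i :
  continuous h -> continuous (fun x => h x 0 i).
Proof.
by move=> hc x; apply: (@continuous_comp _ _ _ h (fun M : 'rV[R]_N => M 0 i));
  [exact: hc|exact: coord_continuous].
Qed.

Lemma continuous_dot (T : topologicalType) (F G : T -> 'rV[R]_N) :
  continuous F -> continuous G -> continuous (fun x => dot (F x) (G x)).
Proof.
by move=> Fc Gc; apply: dot_continuous => i; exact: continuous_coord.
Qed.

Lemma usc_in_penalty (T : topologicalType) (A : set T) (c : R)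
    (F G : T -> 'rV[R]_N) :
  continuous F -> continuous G ->
    usc_in A (fun x => - (c * normsq (F x - G x))).
Proof.
move=> Fc Gc; apply: continuous_usc_in => x.
rewrite (_ : (fun x => _) =
  - (cst c * (fun x => dot (F x - G x) (F x - G x)))) //.
apply: continuousN; apply: continuousM; first exact: cst_continuous.
have FG : continuous (F - G).
  by move=> y; apply: continuousB; [exact: Fc|exact: Gc].
exact: (continuous_dot FG FG).
Qed.

Lemma bounded_setP (A : set 'rV[R]_N) : bounded_set A ->
  exists2 M : R, 0 < M & forall x, A x -> `|x| <= M.
Proof.
move=> [M [Mr MP]]; exists (`|M| + 1) => [|x Ax]; first by rewrite ltr_pwDr.
by apply: (MP (`|M| + 1)) => //; rewrite ltr_pwDr // real_ler_norm.
Qed.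

Lemma closure_norm_le (A : set 'rV[R]_N) (M : R) :
  (forall x, A x -> `|x| <= M) -> forall x, closure A x -> `|x| <= M.
Proof.
move=> AM x xA; apply/ler_addgt0Pr => e e0.
have [y [Ay]] := xA _ (nbhsx_ballx x e e0); rewrite -ball_normE /= => xy.
rewrite -[x](subrK y); apply: le_trans (ler_normD _ _) _.
by rewrite addrC lerD // ?AM // ltW.
Qed.

Lemma compact_closure_bounded (A : set 'rV[R]_N) :
  bounded_set A -> compact (closure A).
Proof.
move=> /bounded_setP[M M0 AM]; apply: bounded_closed_compact;
  last exact: closed_closure.
exists M; split; first exact: num_real.
by move=> M' MM' x /(closure_norm_le AM) xM; exact: le_trans xM (ltW MM').
Qed.

(** Otherwise, by compactness, there are pairs [z], [z'] and points outside [Omega] accumulating at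
    a common boundary point, where semicontinuity contradicts [u <= v]. *)
Lemma boundary_collar (Omega : set 'rV[R]_N) (u v : 'rV[R]_N -> R) (m : R) :
  bounded_set Omega -> open Omega ->
  usc_on (closure Omega) u -> lsc_on (closure Omega) v ->
  (forall x, (closure Omega `\` Omega) x -> u x <= v x) -> 0 < m ->
  exists r : R, 0 < r /\ forall z z', closure Omega z -> closure Omega z' ->
    `|z - z'| < r -> m <= u z - v z' -> forall y, `|y - z| < r -> Omega y.
Proof.
move=> Ob Oo uO vO uv m0; apply: contrapT => /forallNP H.
have r0 (n : nat) : 0 < (n.+1%:R^-1 : R) by rewrite invr_gt0.
have /choice[t tP] : forall n : nat, exists t : 'rV[R]_N * 'rV[R]_N * 'rV[R]_N,
    [/\ closure Omega t.1.1, closure Omega t.1.2, m <= u t.1.1 - v t.1.2,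
      ~ Omega t.2
      & `|t.1.1 - t.1.2| < n.+1%:R^-1 /\ `|t.2 - t.1.1| < n.+1%:R^-1].
  move=> n; apply: contrapT => /forallNP H'; apply: (H n.+1%:R^-1);
    split=> // z z' Oz Oz' zz' muv y yz.
  by apply: contrapT => nOy; apply: (H' (z, z', y)).
pose F := (fun n => (t n).1.1) @ \oo.
have [|z [Oz zcl]] := @compact_closure_bounded _ Ob F _.
  by exists 0%N => // n _ /=; have [] := tP n.
have close (d : R) : 0 < d -> exists n, [/\ `|(t n).1.1 - z| < d,
    `|(t n).1.2 - z| < d & `|(t n).2 - z| < d].
  move=> d0; have d2 : 0 < d / 2 by rewrite divr_gt0.
  have Fn : F [set x | exists2 n, x = (t n).1.1 & n.+1%:R^-1 < d / 2].
    have := near_infty_natSinv_lt (PosNum d2).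
    by apply: filterS => n nd /=; exists n.
  have [x [[n -> nd]]] := zcl _ _ Fn (nbhsx_ballx z _ d2).
  rewrite -ball_normE /= distrC => nz; exists n; have [_ _ _ _ [h1 h2]] := tP n.
  split; first by apply: lt_trans nz _; lra.
    rewrite -[_ - z](subrKA (t n).1.1); apply: le_lt_trans (ler_normD _ _) _.
    by rewrite [ltRHS]splitr ltrD // distrC (lt_trans h1 nd).
  rewrite -[_ - z](subrKA (t n).1.1); apply: le_lt_trans (ler_normD _ _) _.
  by rewrite [ltRHS]splitr ltrD // (lt_trans h2 nd).
have nOz : ~ Omega z.
  move=> /Oo/nbhs_ballP[d /= d0 dO]; have [n [_ _ h]] := close d d0.
  by have [_ _ _ + _] := tP n; apply; apply: dO; rewrite -ball_normE /= distrC.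
have m2 : 0 < m / 2 by rewrite divr_gt0.
have [d1 [d10 d1P]] := uO z Oz _ m2; have [d2 [d20 d2P]] := vO z Oz _ m2.
have d0 : 0 < Num.min d1 d2 by rewrite lt_min d10.
have [n []] := close _ d0; rewrite !lt_min => /andP[h1 _] /andP[_ h2] _.
have [cl1 cl2 muv _ _] := tP n.
by have := d1P _ cl1 h1; have := d2P _ cl2 h2; have := uv z (conj Oz nOz); lra.
Qed.

(** The set is a union of balls of radius [r / 2] about points whose [r]-ball lies in [Omega]; its
    closure thus remains inside [Omega]. *)
Lemma collar_compactly_in (Omega : set 'rV[R]_N) (r : R) :
  bounded_set Omega -> 0 < r ->
  exists X, [/\ open X, Defs.compactly_in X Omega
    & forall z z', (forall y, `|y - z| < r -> Omega y) ->
      `|z - z'| < r / 2 -> X z'].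
Proof.
move=> Ob r0; have r2 : 0 < r / 2 by rewrite divr_gt0.
pose Z := [set z | forall y, `|y - z| < r -> Omega y].
pose X := \bigcup_(z in Z) ball z (r / 2).
have clX : closure X `<=` Omega.
  move=> x xX; have [y [[z zO zy] xy]] := xX _ (nbhsx_ballx x _ r2).
  apply: zO; move: zy xy; rewrite -!ball_normE /= => zy xy.
  rewrite -[x - z](subrKA y); apply: le_lt_trans (ler_normD _ _) _.
  by rewrite [`|y - z|]distrC; lra.
exists X; split.
- by apply: bigcup_open => z _; apply: ball_open.
- split => //; apply: compact_closure_bounded.
  have [M [Mr MP]] := Ob; exists M; split => // M' MM' x Xx; apply: MP => //.
  by apply: clX; exact: subset_closure.
- by move=> z z' zO zz'; exists z => //; rewrite -ball_normE.
Qed.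

End Semicontinuity.

(** * Lasry-Lions regularization *)

Section Convolution.
Set Implicit Arguments. Unset Strict Implicit.
Variables (R : realType) (N : nat) (A : set 'rV[R]_N).
Variables (u v : 'rV[R]_N -> R) (c : R).
Hypothesis Ac : compact A.
Hypothesis A0 : A !=set0.
Hypothesis uA : usc_on A u.
Hypothesis vA : lsc_on A v.
Hypothesis c0 : 0 < c.
Implicit Types (x y z p : 'rV[R]_N).

(** The usual doubled functional, tilted by a linear term in [x + z]; varying the slope [p] moves
    the contact point. *)
Definition doubling p x z : R :=
  u x - v z - c * normsq (x - z) - 2 * c * dot p (x + z).

Definition doubling_max p x z := [/\ A x, A z
  & forall x' z', A x' -> A z' -> doubling p x' z' <= doubling p x z].

Lemma exists_doubling_max p : exists x z, doubling_max p x z.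
Proof.
pose f (t : 'rV[R]_N * 'rV[R]_N) := u t.1 - v t.2 - c * normsq (t.1 - t.2)
  - 2 * c * dot p (t.1 + t.2).
have fc : continuous (fst : 'rV[R]_N * 'rV[R]_N -> _).
  by move=> x; exact: cvg_fst.
have sc : continuous (snd : 'rV[R]_N * 'rV[R]_N -> _).
  by move=> x; exact: cvg_snd.
have [||[x z] /= [Ax Az] H] := @usc_in_max R _ (A `*` A) f (compact_setX Ac Ac).
- by case: A0 => a Aa; exists (a, a).
- apply: usc_inD; last first.
    apply: continuous_usc_in => t.
    rewrite (_ : (fun _ => _) = - (cst (2 * c) * (fun t : 'rV[R]_N * 'rV[R]_N =>
      dot p (t.1 + t.2)))) //.
    apply: continuousN; apply: continuousM; first exact: cst_continuous.
    have FG : continuous (fst + snd : 'rV[R]_N * 'rV[R]_N -> _).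
      by move=> y; apply: continuousD; [exact: fc|exact: sc].
    by apply: (continuous_dot (F := cst p) _ FG); exact: cst_continuous.
  apply: usc_inD; last exact: usc_in_penalty.
  apply: usc_inD; first by apply: (usc_on_usc_in uA fc) => t [].
  by apply: (lsc_on_usc_in vA sc) => t [].
by exists x, z; split => // x' z' Ax' Az'; exact: (H (x', z')).
Qed.

(** The function [F] is the sup-convolution of [u] over [A], whose supremum is attained. *)
Lemma exists_supconv : exists F : 'rV[R]_N -> R, forall y,
  (exists2 z, A z & F y = u z - c * normsq (z - y)) /\
  forall z, A z -> u z - c * normsq (z - y) <= F y.
Proof.
suff /choice[Z ZP] : forall y, exists z, A z /\
    forall z', A z' -> u z' - c * normsq (z' - y) <= u z - c * normsq (z - y).
  by exists (fun y => u (Z y) - c * normsq (Z y - y)) => y; have [] := ZP y;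
    split=> //; exists (Z y).
move=> y; have [|z Az H] :=
  @usc_in_max R _ A (fun z => u z - c * normsq (z - y)) Ac A0.
  apply: usc_inD.
    by apply: (usc_on_usc_in (h := id) uA) => // x; exact: cvg_id.
  by apply: usc_in_penalty; [move=> x; exact: cvg_id|exact: cst_continuous].
by exists z.
Qed.

(* [touching_plane p x z] is the affine majorant of the difference of the
   regularizations attached to a maximum [(x, z)] of [doubling p]; it is
   attained at [contact p x z]. *)
Definition touching_plane p x z y : R :=
  doubling p x z + 4 * c * dot p y + c * normsq p.

Definition contact p x z : 'rV[R]_N := 2^-1 *: (x + z) - 2^-1 *: p.

Lemma doubling_contact p x z y :
  u x - v z - 2 * c * normsq (x - y) - 2 * c * normsq (z - y) =
  touching_plane p x z y - 4 * c * normsq (y - contact p x z).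
Proof.
rewrite /touching_plane /doubling /contact /normsq !dotE (dotC z x) (dotC y x).
by rewrite (dotC y z) (dotC p x) (dotC p y) (dotC p z); field.
Qed.

Lemma doubling_le_plane p x z x' z' y : doubling_max p x z -> A x' -> A z' ->
  u x' - v z' - 2 * c * normsq (x' - y) - 2 * c * normsq (z' - y) <=
  touching_plane p x z y.
Proof.
move=> [_ _ mx] Ax' Az'; rewrite (doubling_contact p).
have : 0 <= 4 * c * normsq (y - contact p x' z').
  by rewrite mulr_ge0 ?normsq_ge0 // mulr_ge0 // ltW.
by rewrite /touching_plane; have := mx _ _ Ax' Az'; lra.
Qed.

(** The paraboloid of one maximum lies below the plane of the other. Comparing both ways, at [a']
    and at a nearby [y], bounds the change of slope by the distance of the contact points. *)
Lemma contact_separated p x z p' x' z' :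
  doubling_max p x z -> doubling_max p' x' z' ->
  normsq (p - p') <= 16 * normsq (contact p x z - contact p' x' z').
Proof.
move=> m1 m2; have [Ax Az _] := m1; have [Ax' Az' _] := m2.
set a := contact p x z; set a' := contact p' x' z'.
(* Displacement along [p - p'], small enough for the linear gain to dominate the quadratic error. *)
pose y := a' + 4^-1 *: (p - p').
have := doubling_le_plane y m2 Ax Az; rewrite (doubling_contact p) -/a.
have := doubling_le_plane a' m1 Ax' Az'; rewrite (doubling_contact p') -/a'.
have -> : normsq (a' - a') = 0 by rewrite subrr /normsq dot0r.
rewrite /touching_plane /y !dotE => h1 h2.
have h3 : c * (dot (p - p') (p - p')
    - 4 * normsq (a' + 4^-1 *: (p - p') - a)) <= 0.
  move: h1 h2; rewrite !dotE; lra.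
have h4 : dot (p - p') (p - p') <= 4 * normsq (a' + 4^-1 *: (p - p') - a).
  by move: h3; rewrite pmulr_rle0 // subr_le0.
have : normsq (a' + 4^-1 *: (p - p') - a) <=
    2 * normsq (a - a') + 8^-1 * normsq (p - p').
  have := normsq_ge0 (a - a' + 4^-1 *: (p - p')).
  have -> : a' + 4^-1 *: (p - p') - a = 4^-1 *: (p - p') - (a - a').
    by apply/rowP => i; rewrite !mxE; ring.
  move: (p - p') (a - a') => q b.
  by rewrite /normsq !dotE (dotC b q); lra.
by rewrite /normsq in h4 *; lra.
Qed.

Section Regularization.
Variable F : 'rV[R]_N -> R.
Hypothesis FP : forall y, (exists2 z, A z & F y = u z - c * normsq (z - y)) /\
  forall z, A z -> u z - c * normsq (z - y) <= F y.

(** Inf-convolution of the sup-convolution. As [F + c normsq] is convex, the larger constant [2 * c]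
    preserves semiconvexity while adding semiconcavity. *)
Definition regularization y : R :=
  inf [set F w + 2 * c * normsq (w - y) | w in [set: 'rV[R]_N]].

Lemma supconv_ge z y w : A z ->
  u z - 2 * c * normsq (z - y) <= F w + 2 * c * normsq (w - y).
Proof.
move=> Az; have := (FP w).2 z Az.
have : c * (2 * normsq (z - y) + 2 * normsq (w - y) - normsq (z - w)) >= 0.
  rewrite mulr_ge0 ?(ltW c0) //; have := normsq_ge0 ((z - y) + (w - y)).
  have -> : z - w = (z - y) - (w - y) by apply/rowP => i; rewrite !mxE; ring.
  by rewrite /normsq !dotE; lra.
by lra.
Qed.

Lemma regularization_has_inf y :
  has_inf [set F w + 2 * c * normsq (w - y) | w in [set: 'rV[R]_N]].
Proof.
split; first by exists (F 0 + 2 * c * normsq (0 - y)); exists 0.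
case: A0 => z Az; exists (u z - 2 * c * normsq (z - y)) => _ [w _ <-].
exact: supconv_ge.
Qed.

Lemma regularization_le y w : regularization y <= F w + 2 * c * normsq (w - y).
Proof.
by apply: ge_inf; [exact: (regularization_has_inf y).2|exists w].
Qed.

Lemma le_regularization (b : R) y :
  (forall w, b <= F w + 2 * c * normsq (w - y)) -> b <= regularization y.
Proof.
move=> H; apply: lb_le_inf => [|_ [w _ <-] //].
exact: (regularization_has_inf y).1.
Qed.

Lemma regularization_ge z y : A z ->
    u z - 2 * c * normsq (z - y) <= regularization y.
Proof. by move=> Az; apply: le_regularization => w; exact: supconv_ge. Qed.

(* For [w = z' - p] the dependence on the maximizer defining [F w] cancels. *)
Lemma regularization_le_plane p x z y z' : doubling_max p x z -> A z' ->
  regularization y <= v z' + 2 * c * normsq (z' - y) + touching_plane p x z y.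
Proof.
move=> [_ _ mx] Az'; apply: le_trans (regularization_le y (z' - p)) _.
have [[x' Ax' ->] _] := FP (z' - p); have := mx _ _ Ax' Az'.
rewrite /touching_plane; move: (doubling p x z) => D; rewrite /doubling /normsq.
rewrite !dotE (dotC z' x') (dotC y z') (dotC p x') (dotC p z') (dotC p y); lra.
Qed.

(** The first half is semiconcavity, since an infimum of paraboloids of opening [2 * c] is taken;
    the second half is semiconvexity inherited from [F]. *)
Lemma regularization_C11 : C11 (2 * c) regularization.
Proof.
move=> a b t /andP[t0 t1]; set m := (1 - t) *: a + t *: b.
have t1' : 0 <= 1 - t by lra.
rewrite ler_norml; apply/andP; split.
  suff : (1 - t) * regularization a + t * regularization b
      - 2 * c * (t * (1 - t)) * normsq (a - b) <= regularization m by lra.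
  apply: le_regularization => w.
  have h1 := ler_wpM2l t1' (regularization_le a w).
  have h2 := ler_wpM2l t0 (regularization_le b w).
  by rewrite normsq_sub_convex; lra.
suff : regularization m <= (1 - t) * regularization a + t * regularization b
      + 2 * c * (t * (1 - t)) * normsq (a - b) by lra.
apply/ler_addgt0Pr => e e0.
have [_ [wa _ <-] ha] := inf_adherent e0 (regularization_has_inf a).
have [_ [wb _ <-] hb] := inf_adherent e0 (regularization_has_inf b).
rewrite -/(regularization a) in ha; rewrite -/(regularization b) in hb.
(* The combination of near-minimizers is the competitor: the loss [c |wa - wb|^2] from [F] is offset
   by the convexity of the penalty, up to [2 c |a - b|^2]. *)
pose w := (1 - t) *: wa + t *: wb.
apply: le_trans (regularization_le m w) _.
have hF : F w <= (1 - t) * F wa + t * F wb +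
    c * (t * (1 - t)) * normsq (wa - wb).
  have [[z Az ->] _] := FP w.
  have h1 := ler_wpM2l t1' ((FP wa).2 z Az);
      have h2 := ler_wpM2l t0 ((FP wb).2 z Az).
  by rewrite normsq_sub_convex; lra.
have hn : normsq (w - m) = (1 - t) * normsq (wa - a) + t * normsq (wb - b)
    - t * (1 - t) * normsq ((wa - wb) - (a - b)).
  rewrite -[wa - wb - (a - b)](_ : (wa - a) - (wb - b) = _) -?normsq_convex.
    by congr normsq; apply/rowP => i; rewrite !mxE; ring.
  by apply/rowP => i; rewrite !mxE; ring.
have hq : c * (t * (1 - t)) * (normsq (wa - wb)
    - 2 * normsq ((wa - wb) - (a - b)) - 2 * normsq (a - b)) <= 0.
  rewrite mulr_ge0_le0 ?mulr_ge0 ?(ltW c0) //.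
  have := normsq_ge0 ((wa - wb) - 2 *: (a - b)).
  move: (wa - wb) (a - b) => q k.
  by rewrite /normsq !dotE (dotC k q); lra.
have h1 := ler_wpM2l t1' (ltW ha); have h2 := ler_wpM2l t0 (ltW hb).
rewrite hn; lra.
Qed.

End Regularization.

End Convolution.

(** * Theorem on sums *)

Section Touching.
Set Implicit Arguments. Unset Strict Implicit.
Variables (R : realType) (N : nat).
Implicit Types (x y z p g : 'rV[R]_N) (S : 'M[R]_N) (c a b : R).

Lemma quad_addE c g S a x b y :
  quad c g S y + a * normsq (y - x) + b =
  quad (c + a * normsq x + b) (g - (2 * a) *: x) (S + (2 * a)%:M) y.
Proof.
rewrite /quad mulmxDr mul_mx_scalar /normsq !dotE (dotC y x).
by field.
Qed.

Lemma quad_translate c g S x : symmx S ->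
  exists c' g', forall y, quad c g S (y - x) = quad c' g' S y.
Proof.
move=> Ss; exists (c - dot g x + 2^-1 * dot (x *m S) x), (g - x *m S) => y.
rewrite /quad mulmxBl !dotE (dot_sym y x Ss).
by field.
Qed.

Lemma symmx_add_scalar S a : symmx S -> symmx (S + a%:M).
Proof. by move=> Ss; rewrite /symmx linearD /= Ss tr_scalar_mx. Qed.

Lemma closed_ball_compact y (rho : R) :
  compact [set w : 'rV[R]_N | `|w - y| <= rho].
Proof.
apply: bounded_closed_compact.
  exists (rho + `|y|); split; first exact: num_real.
  move=> M' MM' w /= wy; rewrite -[w](subrK y).
  apply: le_trans (ler_normD _ _) _; apply: le_trans (ltW MM').
  by rewrite lerD2r.
rewrite (_ : [set _ | _] = (fun w => `|w - y|) @^-1` [set t | t <= rho]) //.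
apply: closed_comp; last exact: closed_le.
move=> w _; apply: (@continuous_comp _ _ _ (id - cst y : 'rV[R]_N ->
  'rV[R]_N) Num.Def.normr).
  by apply: continuousB; [exact: cvg_id|exact: cst_continuous].
exact: norm_continuous.
Qed.

(** The polynomial, steepened by [4 * eta * normsq (y - y0)], is slid down onto the sup-convolution
    of [u]. It touches at an interior [y1], and its translate by [z1 - y1] then touches [u] itself
    at [z1]. *)
Lemma supconv_touch (A : set 'rV[R]_N) (u : 'rV[R]_N -> R) (c rho eta : R)
    cq gq S y0 x0 :
  compact A -> usc_on A u -> 0 < rho -> 0 < eta -> symmx S -> A x0 ->
  (forall z y, A z -> `|y - y0| <= rho ->
     u z - c * normsq (z - y) <= quad cq gq S y + eta * rho ^+ 2) ->
  quad cq gq S y0 - eta * rho ^+ 2 <= u x0 - c * normsq (x0 - y0) ->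
  exists y1 z1 c1 g1 r, [/\ `|y1 - y0| < rho, A z1,
    u z1 = quad c1 g1 (S + (8 * eta)%:M) z1,
    0 < r /\ (forall z, A z -> `|z - z1| < r ->
      u z <= quad c1 g1 (S + (8 * eta)%:M) z)
    & forall z, A z -> u z - c * normsq (z - y1) <=
      u z1 - c * normsq (z1 - y1)].
Proof.
move=> Ac uA rho0 eta0 Ss Ax0 uq q0.
pose B := [set w : 'rV[R]_N | `|w - y0| <= rho].
pose Q y := quad cq gq S y + 4 * eta * normsq (y - y0) + 0.
have fc : continuous (fst : 'rV[R]_N * 'rV[R]_N -> _).
  by move=> x; exact: cvg_fst.
have sc : continuous (snd : 'rV[R]_N * 'rV[R]_N -> _).
  by move=> x; exact: cvg_snd.
have Qc : continuous Q.
  move=> y; rewrite (_ : Q = fun y => quad (cq + 4 * eta * normsq y0 + 0)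
     (gq - (2 * (4 * eta)) *: y0) (S + (2 * (4 * eta))%:M) (y - 0)).
    exact: quad_continuous.
  by apply/funext => w; rewrite subr0 /Q quad_addE.
have [||[y1 z1] /= [By1 Az1] H] := @usc_in_max R _ (B `*` A)
    (fun t => u t.2 - c * normsq (t.2 - t.1) - Q t.1)
    (compact_setX (@closed_ball_compact y0 rho) Ac).
- by exists (y0, x0); split => //=; rewrite /B /= subrr normr0 ltW.
- apply: usc_inD.
    apply: usc_inD; last exact: (@usc_in_penalty R N _ _ c snd fst sc fc).
    by apply: (usc_on_usc_in uA sc) => t [].
  apply: continuous_usc_in => t; apply: (@continuousN _ _ _ (Q \o fst)).
  by apply: continuous_comp; [exact: fc|exact: Qc].
have By0 : B y0 by rewrite /B /= subrr normr0 ltW.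
have h1 := H (y0, x0) (conj By0 Ax0); have h2 := uq _ _ Az1 By1.
have Q0 : Q y0 = quad cq gq S y0 by rewrite /Q subrr /normsq dot0r mulr0 !addr0.
rewrite /= Q0 in h1.
(* The error is at most [eta * rho ^+ 2] on each side, hence [4 eta |y1 - y0|^2 <= 2 eta rho^2]. *)
have near1 : normsq (y1 - y0) <= rho ^+ 2 / 2.
  rewrite -(ler_pM2l eta0); move: h1; rewrite /Q; lra.
have y10 : `|y1 - y0| < rho.
  rewrite -(@ltr_pXn2r _ 2) ?nnegrE ?normr_ge0 ?(ltW rho0) //.
  apply: le_lt_trans (norm_sqr_le_normsq _) _; apply: le_lt_trans near1 _.
  have : 0 < rho ^+ 2 by rewrite exprn_gt0.
  by lra.
have [c1 [g1 c1P]] := quad_translate (cq + 4 * eta * normsq y0 + 0)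
  (gq - (2 * (4 * eta)) *: y0) (z1 - y1) (symmx_add_scalar (2 * (4 * eta)) Ss).
have e8 : 2 * (4 * eta) = 8 * eta by ring.
have QE z : Q (z - (z1 - y1)) = quad c1 g1 (S + (8 * eta)%:M) z.
  by rewrite -e8 -c1P /Q quad_addE.
have Q1 : Q y1 = quad c1 g1 (S + (8 * eta)%:M) z1.
  by rewrite -QE opprB addrCA subrr addr0.
have addb b z : quad c1 g1 (S + (8 * eta)%:M) z + b =
    quad (c1 + b) g1 (S + (8 * eta)%:M) z.
  by rewrite /quad; ring.
exists y1, z1, (c1 + (u z1 - Q y1)), g1, (rho - `|y1 - y0|); split => //.
- by rewrite -addb -Q1 addrC subrK.
- split=> [|z Az zz1]; first by rewrite subr_gt0.
  (* Moving [y] along with [z] keeps [z - y = z1 - y1], so the penalty cancels. *)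
  have By : B (z - (z1 - y1)).
    rewrite /B /= (_ : z - (z1 - y1) - y0 = (z - z1) + (y1 - y0)).
      by apply: le_trans (ler_normD _ _) _; lra.
    by apply/rowP => i; rewrite !mxE; ring.
  have := H (z - (z1 - y1), z) (conj By Az); rewrite /= QE -addb.
  have -> : z - (z - (z1 - y1)) = z1 - y1 by rewrite opprB addrCA subrr addr0.
  by lra.
- by move=> z Az; have := H (y1, z) (conj By1 Az) => /=; lra.
Qed.

End Touching.

(** * Density of the contact points and test functions with nearly equal Hessians *)

Section TheoremOnSums.
Set Implicit Arguments. Unset Strict Implicit.
Variables (R : realType) (N : nat) (A : set 'rV[R]_N) (u v : 'rV[R]_N -> R).
Hypothesis Ac : compact A.
Hypothesis uA : usc_on A u.
Hypothesis vA : lsc_on A v.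
Implicit Types (x y z p g : 'rV[R]_N) (S : 'M[R]_N) (c a b : R).

Definition contact_set c (pmax : R) : set 'rV[R]_N :=
  [set y | exists p x z, [/\ doubling_max A u v c p x z, `|p| <= pmax
                           & y = contact p x z]].

Lemma contact_norm_le (L p0 : R) p x z : `|x| <= L -> `|z| <= L -> `|p| <= p0 ->
  `|contact p x z| <= L + p0.
Proof.
move=> xL zL pp; rewrite /contact -scalerBr normrZ ger0_norm ?invr_ge0 //.
rewrite ler_pdivrMl //; apply: le_trans (ler_normB _ _) _.
have := ler_normD x z; have := normr_ge0 p; lra.
Qed.

(** Slopes are taken on a lattice of spacing [tau]; by [contact_separated] their contact points are
    separated at a comparable scale. *)
Lemma contact_set_dense c (pmax L s : R) : 0 < c -> A !=set0 -> 0 < pmax ->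
  (forall x, A x -> `|x| <= L) -> 0 < s -> s < pmax / (16 * N.+1%:R) ->
  exists n (y : {ffun 'I_N -> 'I_n} -> 'rV[R]_N),
  [/\ pmax / (16 * N.+1%:R) <= n%:R * s,
      forall k, contact_set c pmax (y k) /\ `|y k| <= L + pmax
    & forall k k', k != k' -> s < `|y k - y k'|].
Proof.
move=> c0 A0 p0 AL s0 ss; have N0 : 0 < N.+1%:R :> R by rewrite ltr0n.
(* If two contact points were within [s] in sup norm, then [tau^2 <= 16 N s^2], which this choice
   excludes. A later bound [tau < pmax / 2] absorbs the rounding in [n]. *)
pose tau := 8 * N.+1%:R * s.
have tau0 : 0 < tau by rewrite !mulr_gt0.
have taup : tau < pmax / 2.
  move: ss; rewrite ltr_pdivlMr ?mulr_gt0 // /tau; lra.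
pose n := Num.truncn (pmax / tau).
have /andP[n1 n2] : n%:R <= pmax / tau < n.+1%:R.
  by apply: truncn_itv; rewrite divr_ge0 ?ltW.
rewrite ler_pdivlMr // in n1; rewrite ltr_pdivrMr // -natr1 in n2.
have /choice[y yP] : forall k : {ffun 'I_N -> 'I_n}, exists y,
    exists x z, doubling_max A u v c (tau *: natrv R (fun i => k i)) x z /\
      y = contact (tau *: natrv R (fun i => k i)) x z.
  move=> k; have [x [z xz]] :=
    exists_doubling_max c Ac A0 uA vA (tau *: natrv R (fun i => k i)).
  by exists (contact (tau *: natrv R (fun i => k i)) x z), x, z.
have kp (k : {ffun 'I_N -> 'I_n}) : `|tau *: natrv R (fun i => k i)| <= pmax.
  apply: norm_rV_le => [|i]; first exact: ltW.
  rewrite !mxE ger0_norm; last by apply: mulr_ge0; [exact: ltW|exact: ler0n].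
  apply: le_trans n1; rewrite mulrC ler_pM2r // ler_nat; exact: ltnW.
exists n, y; split.
- rewrite ler_pdivrMr ?mulr_gt0 //; move: n2; rewrite /tau in taup *; lra.
- move=> k; have [x [z [xz ->]]] := yP k; split.
    by exists (tau *: natrv R (fun i => k i)), x, z.
  by have [Ax Az _] := xz; apply: contact_norm_le;
    [exact: AL|exact: AL|exact: kp].
- move=> k k' kk'; have [x [z [xz ->]]] := yP k;
    have [x' [z' [xz' ->]]] := yP k'.
  have := contact_separated c0 xz xz'.
  set d := contact _ _ _ - contact _ _ _ => h1.
  have [i ki] : exists i, k i != k' i.
    apply: contrapT => /forallNP H; move/eqP: kk'; apply; apply/ffunP => i.
    by apply/eqP; apply: contrapT => /negP; exact: H.
  have h2 : tau ^+ 2 <= normsq (tau *: natrv R (fun i => k i) - tau *: natrv R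
      (fun i => k' i)).
    apply: le_trans (norm_sqr_le_normsq _).
    rewrite ler_pXn2r ?nnegrE ?normr_ge0 ?(ltW tau0) //.
    apply: le_trans (coord_le_norm _ 0 i);
      rewrite !mxE -mulrBr normrM gtr0_norm //.
    rewrite ler_pMr //; case: (ltngtP (k i) (k' i)) => [lt|lt|/val_inj e].
    - rewrite distrC -natrB ?(ltnW lt) // normr_nat ler1n subn_gt0 //.
    - rewrite -natrB ?(ltnW lt) // normr_nat ler1n subn_gt0 //.
    - by move: ki; rewrite e eqxx.
  have h3 := normsq_le_norm d.
  rewrite ltNge; apply/negP => ds.
  have h4 : `|d| ^+ 2 <= s ^+ 2 by rewrite ler_pXn2r ?nnegrE ?normr_ge0 ?(ltW
      s0).
  have h5 : N%:R * `|d| ^+ 2 <= N%:R * s ^+ 2 by rewrite ler_wpM2l.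
  have h6 : tau ^+ 2 <= 16 * (N%:R * s ^+ 2) by lra.
  have : 0 < s ^+ 2 by rewrite exprn_gt0.
  have : 0 <= N%:R :> R by [].
  have NE : N.+1%:R = N%:R + 1 :> R by rewrite -natr1.
  move: h6; rewrite /tau NE; move: (N%:R : R) => M.
  have -> : (8 * (M + 1) * s) ^+ 2 = 64 * (M + 1) ^+ 2 * s ^+ 2 by ring.
  by move: (s ^+ 2) => s2; nra.
Qed.

Lemma normsq_diff_le x y : normsq x - normsq y <= N%:R * (`|x - y| * `|x + y|).
Proof.
have -> : normsq x - normsq y = dot (x - y) (x + y).
  by rewrite /normsq !dotE (dotC y x); ring.
exact: le_trans (ler_norm _) (dot_le_norm _ _).
Qed.

(** The regularization is fitted by one polynomial near a contact point, and sliding it against [u]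
    from above and [v] from below gives the same [S] on both sides. *)
Lemma theorem_on_sums x0 (m d eta : R) : A x0 -> 0 < m -> 0 < d -> 0 < eta ->
  2 * m <= u x0 - v x0 ->
  exists z1 z2 S, [/\ symmx S, A z1 /\ A z2, `|z1 - z2| < d, m <= u z1 - v z2
  & (exists c g r, [/\ 0 < r, u z1 = quad c g (S + eta%:M) z1
      & forall z, A z -> `|z - z1| < r -> u z <= quad c g (S + eta%:M) z]) /\
    (exists c g r, [/\ 0 < r, v z2 = quad c g (S - eta%:M) z2
      & forall z, A z -> `|z - z2| < r -> quad c g (S - eta%:M) z <= v z])].
Proof.
move=> Ax0 m0 d0 eta0 uv0; have A0 : A !=set0 by exists x0.
have [L0 L00 AL0] := bounded_setP (compact_bounded Ac).
have idc : continuous (id : 'rV[R]_N -> 'rV[R]_N) by move=> x; exact: cvg_id.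
have [xu Axu xuP] := usc_in_max Ac A0 (usc_on_usc_in (A :=
    A) uA idc (fun _ h => h)).
have [xv Axv xvP] := usc_in_max Ac A0 (lsc_on_usc_in (A :=
    A) vA idc (fun _ h => h)).
pose D := u xu - v xv.
have DP x z : A x -> A z -> u x - v z <= D.
  by move=> Ax Az; have := xuP x Ax; have := xvP z Az; rewrite /D /=; lra.
have D0 : 0 < D by apply: lt_le_trans (DP _ _ Ax0 Ax0); lra.
(* With this [c], a penalty [2 * c * normsq w] of at most [D] forces [|w| <= d / 4]. *)
have [c [c0 cd]] : exists c : R, 0 < c /\ c * d ^+ 2 = 8 * D.
  exists (8 * D / d ^+ 2); split; last by rewrite divfK // expf_neq0 // gt_eqF.
  by rewrite divr_gt0 ?exprn_gt0 // mulr_gt0.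
have [L [L1 AL LL0]] : exists L : R, [/\ 0 < L, forall x, A x ->
    `|x| <= L & L0 + 1 <= L].
  by exists (L0 + 1); split => // [|x /AL0]; lra.
have N0 : 0 < N.+1%:R :> R by rewrite ltr0n.
have NN : N%:R <= N.+1%:R :> R by rewrite ler_nat.
(* The tilt [4 * c * dot p w] is at most [m / 4] for [|w| <= L]; the bound by [1] keeps contact
   points within norm [L]. *)
pose pmax := Num.min 1 (m / (16 * c * N.+1%:R * L)).
have k0 : 0 < 16 * c * N.+1%:R * L by rewrite !mulr_gt0.
have pmax0 : 0 < pmax by rewrite lt_min ltr01 divr_gt0.
have pmax1 : pmax <= 1 by rewrite ge_min lexx.
have pmaxm : pmax * (16 * c * N.+1%:R * L) <= m.
  by rewrite -ler_pdivlMr // ge_min lexx orbT.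
have [F FP] := exists_supconv c Ac A0 uA.
pose phi := regularization c F.
have phiC : C11 (2 * c) phi by exact: (regularization_C11 A0 c0 FP).
(* Moving [y] by [rho0] changes a penalty by at most [m / 4], and [d / 8] is its share of the
   distance between [z1] and [z2]. *)
pose rho0 := Num.min (Num.min 1 (d / 8)) (m / (8 * c * N.+1%:R * (4 * L + 1))).
have k1 : 0 < 8 * c * N.+1%:R * (4 * L + 1) by rewrite !mulr_gt0 //; lra.
have rho00 : 0 < rho0 by rewrite !lt_min ltr01 !divr_gt0.
have c20 : 0 <= 2 * c by lra.
have sep0 : 0 < pmax / (16 * N.+1%:R) by rewrite divr_gt0 // mulr_gt0.
have eta8 : 0 < eta / 8 by rewrite divr_gt0.
have dense s : 0 < s -> s < pmax / (16 * N.+1%:R) ->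
    exists n (y : {ffun 'I_N -> 'I_n} -> 'rV[R]_N),
    [/\ pmax / (16 * N.+1%:R) <= n%:R * s,
      forall k, contact_set c pmax (y k) /\ `|y k| <= L
      & forall k k', k != k' -> s < `|y k - y k'|].
  move=> s0 ss; have [n [y [h1 h2 h3]]] :=
    contact_set_dense c0 A0 pmax0 AL0 s0 ss.
  exists n, y; split => // k; have [] := h2 k; split => //; lra.
have [y0 [rho [cq [gq [S [zq [Ey0 /andP[rhop rhoL] Ss fit]]]]]]] :=
  exists_quad_approx phiC c20 L1 sep0 sep0 dense eta8 rho00.
have [cq' [gq' qE]] := quad_translate cq gq zq Ss.
have rho1 : rho <= 1 /\ rho < d / 8 /\ rho * (8 * c * N.+1%:R * (4 * L +
    1)) <= m.
  move: rhoL; rewrite !lt_min => /andP[/andP[r1 r2] r3]; split;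
    first exact: ltW.
  by split => //; rewrite -ler_pdivlMr // ltW.
have {rho1}[rho1 [rhod rhom]] := rho1.
have [p [x [z [mx pP y0E]]]] := Ey0; have [Ax Az _] := mx.
have y0L : `|y0| <= L.
  rewrite y0E; apply: le_trans (contact_norm_le (AL0 _ Ax) (AL0 _ Az) pP) _;
    lra.
pose plane := touching_plane u v c p x z.
pose val := u x - v z - 2 * c * normsq (x - y0) - 2 * c * normsq (z - y0).
have valE : val = plane y0.
  by rewrite /val (doubling_contact u v c p) y0E subrr /normsq dot0r mulr0
    subr0.
have fitq y : `|y - y0| <= rho ->
    quad cq' gq' S y - eta / 8 * rho ^+ 2 <= phi y <=
    quad cq' gq' S y + eta / 8 * rho ^+ 2.
  move=> yy; have := fit y yy; rewrite qE ler_norml => /andP[h1 h2].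
  by apply/andP; split; lra.
have y00 : `|y0 - y0| <= rho by rewrite subrr normr0 ltW.
have phi_ge w y : A w -> u w - 2 * c * normsq (w - y) <= phi y.
  exact: (regularization_ge A0 c0 FP).
have phi_le w y : A w -> phi y <= v w + 2 * c * normsq (w - y) + plane y.
  exact: (regularization_le_plane A0 c0 FP _ mx).
have e8 : 8 * (eta / 8) = eta by field.
(* At [y0] the bounds [phi_ge] and [phi_le] coincide, since [val = plane y0]; hence the fitted
   polynomial almost touches the convolutions of [u] and, after subtraction from the plane, of
   [- v]. *)
have [y1 [z1 [c1 [g1 [r1 [y1y0 Az1 uz1 [r10 uz1P] mz1]]]]]] :
    exists y1 z1 c1 g1 r, [/\ `|y1 - y0| < rho, A z1,
    u z1 = quad c1 g1 (S + eta%:M) z1,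
    0 < r /\ (forall z, A z -> `|z - z1| < r ->
      u z <= quad c1 g1 (S + eta%:M) z)
    & forall z, A z -> u z - 2 * c * normsq (z - y1) <=
      u z1 - 2 * c * normsq (z1 - y1)].
  rewrite -e8; apply: (supconv_touch (cq := cq') (gq := gq') (x0 := x)) => //.
    by move=> w y Aw yy; have := phi_ge w y Aw; have := fitq y yy; lra.
  by have := phi_le z y0 Az; rewrite -valE /val; have := fitq y0 y00; lra.
have qN y : quad (- cq' + doubling u v c p x z + c * normsq p) (- gq' +
    (4 * c) *: p) (- S) y
    = - quad cq' gq' S y + plane y.
  by rewrite /plane /touching_plane /quad mulmxN !dotE; ring.
have [y2 [z2 [c2 [g2 [r2 [y2y0 Az2 vz2 [r20 vz2P] mz2]]]]]] :
    exists y1 z1 c1 g1 r, [/\ `|y1 - y0| < rho, A z1,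
    - v z1 = quad c1 g1 (- S + eta%:M) z1,
    0 < r /\ (forall z, A z -> `|z - z1| < r ->
      - v z <= quad c1 g1 (- S + eta%:M) z)
    & forall z, A z -> - v z - 2 * c * normsq (z - y1) <=
      - v z1 - 2 * c * normsq (z1 - y1)].
  rewrite -e8; apply: (supconv_touch (u := fun w => - v w)
    (cq := - cq' + doubling u v c p x z + c * normsq p)
    (gq := - gq' + (4 * c) *: p) (x0 := z)) => //.
  - move=> w Aw e e0; have [d' [d'0 d'P]] := vA Aw e0; exists d';
      split=> // w' Aw' ww'.
    by have := d'P _ Aw' ww'; lra.
  - by rewrite /symmx linearN /= Ss.
  - move=> w y Aw yy; rewrite qN; have := phi_le w y Aw; have := fitq y yy; lra.
  - rewrite qN; have := phi_ge x y0 Ax; have := fitq y0 y00.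
    by rewrite -valE /val; lra.
have val_ge : 3 / 2 * m <= val.
  rewrite valE /plane /touching_plane; have [_ _ /(_ x0 x0 Ax0 Ax0)] := mx.
  rewrite {1}/doubling subrr {1}/normsq dot0r mulr0 subr0 dotDr.
  have b w : `|w| <= L -> `|4 * c * dot p w| <= m / 4.
    move=> wL; rewrite normrM ger0_norm; last by lra.
    apply: le_trans (_ : 4 * c * (N.+1%:R * (pmax * L)) <= _); last by lra.
    rewrite ler_pM2l; last by lra.
    apply: le_trans (dot_le_norm _ _) _; apply: ler_pM => //.
    by apply: ler_pM.
  have := b _ (AL _ Ax0); have := b _ y0L;
      rewrite !ler_norml => /andP[b1 _] /andP[_ b2].
  have : 0 <= c * normsq p by rewrite mulr_ge0 ?normsq_ge0 // ltW.
  by lra.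
have small w y : A w -> `|y - y0| <= rho ->
    2 * c * normsq (w - y) <= 2 * c * normsq (w - y0) + m / 4.
  move=> Aw yy; have := normsq_diff_le (w - y) (w - y0).
  have -> : w - y - (w - y0) = - (y - y0) by apply/rowP => i; rewrite !mxE;
      ring.
  have hw := AL _ Aw.
  have hs : `|w - y + (w - y0)| <= 4 * L + 1.
    have -> : w - y + (w - y0) = (w + w) - (y0 + y0) - (y - y0).
      by apply/rowP => i; rewrite !mxE; ring.
    apply: le_trans (ler_normB _ _) _.
    have := ler_normB (w + w) (y0 + y0); have := ler_normD w w;
        have := ler_normD y0 y0; lra.
  rewrite normrN => h.
  have h' : N%:R * (`|y - y0| * `|w - y + (w - y0)|) <=
      N.+1%:R * (rho * (4 * L + 1)).
    apply: ler_pM => //.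
    by apply: ler_pM.
  have := ler_wpM2l (ltW c0) (le_trans h h'); lra.
(* Of [3 / 2 * m], each of the moves from [y0] to [y1] and to [y2] uses up at most [m / 4]. *)
have key : m + 2 * c * normsq (z1 - y1) + 2 * c * normsq (z2 - y2) <=
    u z1 - v z2.
  have := mz1 _ Ax; have := mz2 _ Az.
  have := small _ _ Ax (ltW y1y0); have := small _ _ Az (ltW y2y0).
  move: val_ge; rewrite /val; lra.
have cn1 (w : 'rV[R]_N) : 0 <=
    2 * c * normsq w by rewrite mulr_ge0 ?normsq_ge0 //; lra.
have close (w : 'rV[R]_N) : 2 * c * normsq w <= D -> `|w| <= d / 4.
  move=> h; apply: norm_le_of_normsq; first by lra.
  have c2p : 0 < 2 * c by lra.
  by rewrite -(ler_pM2l c2p); apply: le_trans h _; rewrite expr_div_n; lra.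
have d1 : `|z1 - y1| <= d / 4.
  by apply: close; have := DP _ _ Az1 Az2; have := cn1 (z2 - y2); lra.
have d2 : `|z2 - y2| <= d / 4.
  by apply: close; have := DP _ _ Az1 Az2; have := cn1 (z1 - y1); lra.
exists z1, z2, S; split => //.
- have -> : z1 - z2 = ((z1 - y1) + (y1 - y0)) - ((z2 - y2) + (y2 - y0)).
    by apply/rowP => i; rewrite !mxE; ring.
  apply: le_lt_trans (ler_normB _ _) _.
  have := ler_normD (z1 - y1) (y1 - y0);
      have := ler_normD (z2 - y2) (y2 - y0); lra.
- by have := cn1 (z1 - y1); have := cn1 (z2 - y2); lra.
- have qN' w : quad (- c2) (- g2) (S - eta%:M) w =
    - quad c2 g2 (- S + eta%:M) w.
    have -> : S - eta%:M = - (- S + eta%:M) by rewrite opprD opprK.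
    by rewrite /quad mulmxN !dotE; ring.
  split; first by exists c1, g1, r1.
  exists (- c2), (- g2), r2; split => //; first by rewrite qN' -vz2 opprK.
  by move=> w Aw ww; rewrite qN'; have := vz2P w Aw ww; lra.
Qed.

End TheoremOnSums.

(** * Comparison *)

Section Comparison.
Set Implicit Arguments. Unset Strict Implicit.
Variables (R : realType) (N : nat).

(** The matrix norm is the largest entry, so the quadratic form of [Y] is at most [N e |w|^2], by
    the inequality of arithmetic and geometric means. *)
Lemma psdmx_scalar_add (Y : 'M[R]_N) (a e : R) : symmx Y ->
  `|Y| <= e -> N%:R * e <= a -> psdmx (a%:M + Y).
Proof.
move=> Ys Ye ea; split; first by rewrite /symmx linearD /= Ys tr_scalar_mx.
move=> w; have -> : (w *m (a%:M + Y) *m w^T) 0 0 =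
  a * normsq w + dot (w *m Y) w.
  rewrite mulmxDr mulmxDl mxE mul_mx_scalar -scalemxAl; congr (_ + _);
    rewrite !mxE.
    by congr (_ * _); apply: eq_bigr => i _; rewrite !mxE.
  by apply: eq_bigr => i _; rewrite !mxE.
have e0 : 0 <= e by exact: le_trans (normr_ge0 _) Ye.
suff : `|dot (w *m Y) w| <= N%:R * e * normsq w.
  rewrite ler_norml => /andP[h _].
  have := ler_wpM2r (normsq_ge0 w) ea; lra.
apply: le_trans (_ : \sum_i \sum_j e * (2^-1 * (w 0 i ^+ 2 + w 0 j ^+ 2)) <= _).
  apply: le_trans (ler_norm_sum _ _ _) _; apply: ler_sum => i _.
  rewrite mxE mulr_suml; apply: le_trans (ler_norm_sum _ _ _) _.
  apply: ler_sum => j _; rewrite mulrAC normrM mulrC.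
  apply: ler_pM => //; first exact: le_trans (coord_le_norm _ _ _) Ye.
  rewrite normrM -[w 0 i ^+ 2]real_normK ?num_real // -[w 0 j ^+ 2]real_normK
    ?num_real //.
  by have := sqr_ge0 (`|w 0 i| - `|w 0 j|); lra.
under eq_bigr do rewrite -mulr_sumr -mulr_sumr big_split /=.
rewrite -mulr_sumr -mulr_sumr big_split /= sumr_const card_ord.
have nE : \sum_(i < N) w 0 i ^+ 2 = normsq w by apply: eq_bigr => i _;
    rewrite expr2.
under eq_bigr do rewrite sumr_const card_ord.
rewrite sumrMnl nE (_ : normsq w *+ N = N%:R * normsq w);
  last by rewrite mulr_natl.
lra.
Qed.

Lemma usc_on_add_normsq (A : set 'rV[R]_N) u (k C : R) : usc_on A u ->
  usc_on A (fun x => u x + k * (normsq x - C)).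
Proof.
move=> uA x Ax e e0; have e2 : 0 < e / 2 by rewrite divr_gt0.
have [d [d0 dP]] := uA x Ax _ e2.
have nc : continuous (fun x : 'rV[R]_N => k * (normsq x - C)).
  move=> y; rewrite (_ : (fun _ => _) =
    cst k * ((fun x => dot x x) - cst C)) //.
  apply: continuousM; first exact: cst_continuous.
  apply: continuousB; last exact: cst_continuous.
  by apply: continuous_dot => z; exact: cvg_id.
have /cvgrPdist_lt/(_ _ e2) := nc x; case/nbhs_ballP => d' /= d'0 d'P.
exists (Num.min d d'); split; first by rewrite lt_min d0.
move=> y Ay; rewrite lt_min => /andP[yd yd'].
have := dP y Ay yd; have := d'P y; rewrite -ball_normE /= distrC => /(_ yd').
by rewrite ltr_norml => /andP[h1 h2] h3; lra.
Qed.

End Comparison.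

Theorem theorem5p7 (R : realType) (N : nat) (Omega : set 'rV[R]_N)
    (Theta : 'rV[R]_N -> set (R * 'M[R]_N)) (u v : 'rV[R]_N -> R) :
  bounded_set Omega -> open Omega -> connected Omega ->
  proper_elliptic Omega Theta ->
  theta_unif_cont Omega Theta ->
  usc_on (closure Omega) u -> subharmonic Omega Theta u ->
  lsc_on (closure Omega) v -> superharmonic Omega Theta v ->
  (forall x, (closure Omega `\` Omega) x -> u x <= v x) ->
  forall x, Omega x -> u x <= v x.
Proof.
move=> Ob Oo _ ell unif uO sub vO sup uv x0 Ox0.
rewrite leNgt; apply/negP => vu0.
have Ac := compact_closure_bounded Ob.
have [L L0 OL] := bounded_setP Ob; have clL := closure_norm_le OL.
have Ax0 : closure Omega x0 by exact: subset_closure.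
have [C [C0 CP]] : exists C : R, 0 < C /\ forall x, closure Omega x ->
    normsq x <= C.
  exists (N%:R * L ^+ 2 + 1); split=> [|x /clL xL].
    by apply: ltr_wpDl => //; rewrite mulr_ge0 ?sqr_ge0.
  apply: le_trans (normsq_le_norm x) _.
  apply: le_trans (_ : N%:R * L ^+ 2 <= _); last by lra.
  by apply: ler_wpM2l; rewrite ?ler0n // lerXn2r ?nnegrE ?normr_ge0 ?(ltW L0).
(* [k] is the Hessian gap of the strict subsolution [u + k/2 (|x|^2 - C)]. *)
have [k [k0 kC]] : exists k : R, 0 < k /\ k * C = u x0 - v x0.
  exists ((u x0 - v x0) / C); split; last by rewrite divfK ?gt_eqF.
  by rewrite divr_gt0 ?subr_gt0.
(* As [k * C = 4 * m], the perturbation lowers the gap [4 * m] at [x0] by at most [2 * m]. *)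
pose m := (u x0 - v x0) / 4.
have m0 : 0 < m by rewrite divr_gt0 ?subr_gt0.
pose ut x := u x + k / 2 * (normsq x - C).
have ut_le x : closure Omega x -> ut x <= u x.
  by move=> /CP xC; rewrite /ut gerDl pmulr_rle0 ?subr_le0 // divr_gt0.
have utO : usc_on (closure Omega) ut by exact: usc_on_add_normsq.
have utv x : (closure Omega `\` Omega) x -> ut x <= v x.
  by move=> xb; apply: le_trans (uv x xb); apply: ut_le; case: xb.
have ut0 : 2 * m <= ut x0 - v x0.
  rewrite /ut /m; have : 0 <=
    k * normsq x0 by rewrite mulr_ge0 ?normsq_ge0 // ltW.
  by lra.
have [r [r0 rP]] := boundary_collar Ob Oo utO vO utv m0.
have [X [Xo Xc XP]] := collar_compactly_in Ob r0.
have [R0 R0P] := unif X Xo Xc.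
have A0 : closure Omega !=set0 by exists x0.
have idc : continuous (id : 'rV[R]_N -> 'rV[R]_N) by move=> x; exact: cvg_id.
have [xu Axu xuP] := usc_in_max Ac A0 (usc_on_usc_in uO idc (fun _ h => h)).
have [xv Axv xvP] := usc_in_max Ac A0 (lsc_on_usc_in vO idc (fun _ h => h)).
(* The value [u z1] lies between the minimum of [v] and the maximum of [u], so this bound can be
   fixed before [z1] is found. *)
have [Rr [Rr0 RrR RrP]] : exists Rr : R, [/\ 0 < Rr, R0 <= Rr &
    forall t, v xv <= t <= u xu -> `|t| <= Rr].
  exists (`|R0| + `|u xu| + `|v xv| + 1); split.
  - have := normr_ge0 R0; have := normr_ge0 (u xu); have := normr_ge0 (v xv);
      lra.
  - have := ler_norm R0; have := normr_ge0 (u xu); have := normr_ge0 (v xv);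
      lra.
  - move=> t /andP[t1 t2]; rewrite ler_norml.
    have := normr_ge0 R0; have := normr_ge0 (u xu); have := normr_ge0 (v xv).
    have := ler_norm (u xu); have := ler_norm (- v xv); rewrite normrN => *.
    by apply/andP; split; lra.
(* Budget for the gap [k]: the two test functions use [k / 8] each and the continuity of [Theta]
   uses [k / 4], leaving [k / 2] for a full neighbourhood of the jet of [v]. *)
have k4 : 0 < k / 4 by rewrite divr_gt0.
have [delta [delta0 deltaP]] := R0P Rr RrR Rr0 _ k4.
pose d := Num.min delta (r / 2).
have d0 : 0 < d by rewrite lt_min delta0 divr_gt0.
have k8 : 0 < k / 8 by rewrite divr_gt0.
have [z1 [z2 [S [Ss [Az1 Az2] z12 uvz]]]] :=
    theorem_on_sums Ac utO vO Ax0 m0 d0 k8 ut0.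
case=> -[c1 [g1 [r1 [r10 uz1 uz1P]]]] [c2 [g2 [r2 [r20 vz2 vz2P]]]].
move: z12; rewrite lt_min => /andP[z12d z12r].
have z1r : forall y, `|y - z1| < r -> Omega y.
  by apply: (rP z1 z2) => //; apply: lt_trans z12r _; lra.
have Xz1 : X z1 by apply: (XP z1) => //; rewrite subrr normr0 divr_gt0.
have Xz2 : X z2 by exact: (XP z1).
have Oz1 : Omega z1 by apply: z1r; rewrite subrr normr0.
have Oz2 : Omega z2 by apply: z1r; rewrite distrC; apply: lt_trans z12r _; lra.
have uE x : u x = ut x + (- (k / 2)) * normsq (x - 0) + k / 2 * C.
  by rewrite /ut subr0; ring.
have Ju : superjet u z1 (u z1, S + (k / 8)%:M + (2 * - (k / 2))%:M).
  have r10' : 0 < Num.min r r1 by rewrite lt_min r0.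
  pose cu := c1 + - (k / 2) * normsq (0 : 'rV[R]_N) + k / 2 * C.
  pose gu := g1 - (2 * - (k / 2)) *: (0 : 'rV[R]_N).
  have qE w : quad cu gu (S + (k / 8)%:M + (2 * - (k / 2))%:M) (w - 0) =
      quad c1 g1 (S + (k / 8)%:M) w + - (k / 2) * normsq (w - 0) + k / 2 * C.
    by rewrite quad_addE [in LHS]subr0.
  apply: (superjet_quad (c := cu) (g := gu) (z := 0) r10').
  - by do 2! apply: symmx_add_scalar.
  - move=> y; rewrite lt_min => /andP[yr yr1]; rewrite uE qE.
    rewrite !lerD2r; apply: uz1P => //.
    by apply: subset_closure; exact: z1r.
  - by rewrite uE qE uz1.
have SsB : symmx (S - (k / 8)%:M) by rewrite /symmx linearB /= Ss tr_scalar_mx.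
have Jv : subjet v z2 (v z2, S - (k / 8)%:M).
  have [r3 r30 r3P] : exists2 r3 : R, 0 < r3 & forall y, `|y - z2| < r3 ->
      Omega y.
    have /nbhs_ballP[r3 /= r30 r3P] := Oo _ Oz2.
    by exists r3 => // y yz; apply: r3P; rewrite -ball_normE /= distrC.
  have r20' : 0 < Num.min r3 r2 by rewrite lt_min r30.
  apply: (subjet_quad (z := 0) r20').
  - exact: SsB.
  - move=> y; rewrite lt_min => /andP[yr yr2]; rewrite subr0; apply: vz2P => //.
    by apply: subset_closure; exact: r3P.
  - by rewrite subr0.
have Tu := sub _ Oz1 _ Ju.
have uz1_ge : v z2 + m <= u z1 by have := ut_le _ Az1; lra.
have uR : `|u z1| <= Rr.
  apply: RrP; have := xuP _ Az1; have := xvP _ Az2 => /=.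
  by move=> h1 h2; apply/andP; split; lra.
have Tu2 := deltaP _ _ Xz1 Xz2 z12d _ _ Tu uR.
apply: (sup _ Oz2 _ Jv); split; first exact: SsB.
have N0 : 0 < N.+1%:R :> R by rewrite ltr0n.
(* The jet of [v] is shown to be interior to [Theta z2]: [s] within [m] of [v z2] stays below
   [u z1], and entries of [Y] within the second bound leave the [k / 2] margin nonnegative. *)
exists (Num.min m (k / 2 / N.+1%:R)); split.
  by rewrite lt_min m0 !divr_gt0.
move=> s Y Ys; rewrite /= !lt_min => /andP[sm _] /andP[_ Yk].
have [_ _ _ _ ellP] := ell _ Oz2.
have -> : s = u z1 + (s - u z1) by rewrite addrC subrK.
set A1 := S + (k / 8)%:M + _ + _ in Tu2.
have -> : Y = A1 + ((k / 2)%:M + (Y - (S - (k / 8)%:M))).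
  apply/matrixP => i j; rewrite /A1 !mxE.
  by case: (i == j); rewrite ?mulr1n ?mulr0n; field.
apply: ellP => //.
  by move: sm; rewrite ltr_norml => /andP[_ h]; lra.
apply: psdmx_scalar_add (ltW Yk) _.
  by rewrite /symmx linearB /= Ys SsB.
rewrite mulrA ler_pdivrMr // mulrC ler_wpM2l ?ler_nat //.
by rewrite divr_ge0 // ltW.
Qed.
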